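(* Let $p$ be a prime. Let $H$ and $K$ be finitely generated nilpotent groups which are conjugacy $p$-separable, let $A\leqslant H$ and $B\leqslant K$ be central subgroups which are $p'$-isolated in $H$ and in $K$ respectively, and let $\varphi:A\to B$ be an isomorphism. Then $G=\bigl(H*K;\ A=B,\ \varphi\bigr)$ is a conjugacy $p$-separable group.
   Context: $\bigl(H*K;\ A=B,\ \varphi\bigr)$ denotes the free product of $H$ and $K$ with subgroups $A$ and $B$ amalgamated via the isomorphism $\varphi$. A group $G$ is conjugacy $p$-separable if whenever $a,b\in G$ are not conjugate in $G$, there is a homomorphism $\psi$ of $G$ onto a finite $p$-group $X$ such that $a\psi$ and $b\psi$ are not conjugate in $X$. For a prime $q$, a subgroup $X$ of a group $Y$ is $q$-isolated if $y^q\in X$ implies $y\in X$ for every $y\in Y$; $X$ is $p'$-isolated if it is $q$-isolated for every prime $q\neq p$. A subgroup is central if it lies in the center of the group. *)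

(* Defs.v *)
From mathcomp Require Import all_boot all_fingroup all_solvable.
Set Implicit Arguments. Unset Strict Implicit. Unset Printing Implicit Defensive.

Record grp := Grp {
  gcar :> Type;
  gmul : gcar -> gcar -> gcar;
  gone : gcar;
  ginv : gcar -> gcar;
  gmulA : forall x y z, gmul x (gmul y z) = gmul (gmul x y) z;
  gmul1 : forall x, gmul gone x = x;
  gmulV : forall x, gmul (ginv x) x = gone
}.
Arguments gmul {g}. Arguments gone {g}. Arguments ginv {g}.

Fixpoint gpow (G : grp) (x : G) (n : nat) : G :=
  match n with 0 => gone | n'.+1 => gmul x (gpow x n') end.

Definition is_hom (G L : grp) (f : G -> L) : Prop :=
  forall x y, f (gmul x y) = gmul (f x) (f y).

Definition is_subgroup (G : grp) (S : G -> Prop) : Prop :=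
  [/\ S gone, (forall x y, S x -> S y -> S (gmul x y)) & (forall x, S x -> S (ginv x))].

Definition gen (G : grp) (S : G -> Prop) (x : G) : Prop :=
  forall P : G -> Prop, is_subgroup P -> (forall y, S y -> P y) -> P x.

Definition gcomm (G : grp) (x y : G) : G :=
  gmul (gmul (gmul (ginv x) (ginv y)) x) y.

(* lower central series: lcs G n = gamma_{n+1}(G) *)
Fixpoint lcs (G : grp) (n : nat) : G -> Prop :=
  match n with
  | 0 => fun _ => True
  | n'.+1 => @gen G (fun z : G => exists x y : G, @lcs G n' x /\ z = gcomm x y)
  end.

Definition nilpotent_grp (G : grp) : Prop :=
  exists c, forall x : G, @lcs G c x -> x = gone.

Definition fin_generated (G : grp) : Prop :=
  exists n (f : 'I_n -> G), forall x, gen (fun y => exists i, y = f i) x.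

Definition conj_in (G : grp) (a b : G) : Prop :=
  exists g : G, b = gmul (gmul (ginv g) a) g.

Definition conj_p_separable (p : nat) (G : grp) : Prop :=
  forall a b : G, ~ conj_in a b ->
    exists (gT : finGroupType) (psi : G -> gT),
      [/\ (forall x y, psi (gmul x y) = (psi x * psi y)%g),
          (forall z : gT, exists x, psi x = z),
          (p.-group [set: gT])%g &
          ~ (exists g : gT, psi b = (psi a ^ g)%g)].

Definition central (G : grp) (A : G -> Prop) : Prop :=
  forall a, A a -> forall h : G, gmul a h = gmul h a.

Definition q_isolated (G : grp) (q : nat) (A : G -> Prop) : Prop :=
  forall y : G, A (gpow y q) -> A y.

Definition pprime_isolated (G : grp) (p : nat) (A : G -> Prop) : Prop :=
  forall q, prime q -> q != p -> q_isolated q A.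

Definition iso_on (H K : grp) (A : H -> Prop) (B : K -> Prop) (phi : H -> K) : Prop :=
  [/\ (forall a, A a -> B (phi a)),
      (forall a a', A a -> A a' -> phi (gmul a a') = gmul (phi a) (phi a')),
      (forall a a', A a -> A a' -> phi a = phi a' -> a = a') &
      (forall b, B b -> exists2 a, A a & phi a = b)].

(* (G, iH, iK) is the free product of H and K amalgamating A with B via phi,
   characterized by its universal property (pushout in the category of groups). *)
Definition is_amalgam (H K : grp) (A : H -> Prop) (phi : H -> K)
    (G : grp) (iH : H -> G) (iK : K -> G) : Prop :=
  [/\ is_hom iH, is_hom iK, (forall a, A a -> iH a = iK (phi a)) &
      forall (L : grp) (fH : H -> L) (fK : K -> L),
        is_hom fH -> is_hom fK -> (forall a, A a -> fH a = fK (phi a)) ->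
        exists f : G -> L,
          [/\ is_hom f, (forall h, f (iH h) = fH h), (forall k, f (iK k) = fK k) &
              forall f' : G -> L, is_hom f' -> (forall h, f' (iH h) = fH h) ->
                (forall k, f' (iK k) = fK k) -> forall x, f' x = f x]].

(* Main.v *)
Require Import Defs.
From mathcomp Require Import all_boot all_order all_algebra all_fingroup all_solvable.
From mathcomp Require Import boolp zify.
Set Implicit Arguments. Unset Strict Implicit. Unset Printing Implicit Defensive.
Import GRing.Theory Num.Theory.

(** A word of minimal length shows that every element of G is conjugate either to an element of a
    factor or to a cyclically reduced alternating word.

    Elements of a factor are separated in central products of finite p-groups.  A finite p-quotient
    of H extends to such a product because a p'-isolated normal subgroup of a finitely generated
    nilpotent group is an intersection of normal subgroups of p-power index (Gruenberg, Hall).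

    For a cyclically reduced word a = x_0 ... x_(N-1), the group G acts on a free module with basis
    vectors placed along the cycle of positions of a: a letter either stays at a position or, with
    weight t, moves one position forward if the position has been read correctly.  The coefficient
    of t^N in the trace of a word b of length at most N counts the starting positions from which b
    winds once around the cycle, so it is positive for b = a and it vanishes when b is not conjugate
    to a.  For t divisible by p the action is, modulo p, by permutations coming from finite p-groups,
    hence its reduction modulo any power of p has a finite p-group as image. *)

(* The two finite p-groups behind the winding action have different tasks. [Q] kills the amalgamated
   subgroup and decides whether letters agree modulo it. A word that winds once is then a cyclic
   shift of a times a factor d from the amalgamated subgroup, central in G. At most one candidate d
   per starting position has to be tested, so [P] can be chosen afterwards to detect these finitely
   many elements; the last component of a state accumulates d, and the winding counts only if d dies
   in [P]. Using the difference g - 1 as the weight of a step makes the action multiplicative on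
   each factor, and lets an amalgamated element act alike from both sides. It causes no cancellation
   in the trace: the diagonal entries that matter are 0 or 1. The traces of a and b are polynomials
   in t. If they differ, they differ at some power of p, and the difference survives modulo a high
   power of p. The bound on the length of b is harmless because separation is symmetric: the longer
   word plays the role of a. Being p'-isolated makes the relevant quotients free of torsion prime to
   p, which is what turns finite quotients into p-groups. *)
Declare Scope grp_scope.
Delimit Scope grp_scope with grp.
Notation "x * y" := (gmul x y) : grp_scope.
Notation "x ^-1" := (ginv x) : grp_scope.
Notation "x ^+ n" := (gpow x n) : grp_scope.
Notation "1" := gone : grp_scope.
Local Open Scope grp_scope.

(** * Groups, subgroups and powers *)

Section Basics.
Variable G : grp.
Implicit Types x y z : G.

Lemma gmulKV x y : x^-1 * (x * y) = y.
Proof. by rewrite gmulA gmulV gmul1. Qed.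

Lemma gmulI x y z : x * y = x * z -> y = z.
Proof. by move=> e; rewrite -(gmulKV x y) e gmulKV. Qed.

Lemma gmulVr x : x * x^-1 = 1.
Proof. by rewrite -[LHS]gmul1 -{1}(gmulV x^-1) -gmulA (gmulKV x) gmulV. Qed.

Lemma gmul1r x : x * 1 = x.
Proof. by rewrite -(gmulV x) gmulA gmulVr gmul1. Qed.

Lemma gmulVK x y : x * (x^-1 * y) = y.
Proof. by rewrite gmulA gmulVr gmul1. Qed.

Lemma ginv_uniq x y : x * y = 1 -> y = x^-1.
Proof. by move=> e; apply: (@gmulI x); rewrite e gmulVr. Qed.

Lemma ginvK x : x^-1^-1 = x.
Proof. by apply/esym/ginv_uniq; rewrite gmulV. Qed.

Lemma ginv1 : (1 : G)^-1 = 1.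
Proof. by apply/esym/ginv_uniq; rewrite gmul1. Qed.

Lemma ginvM x y : (x * y)^-1 = y^-1 * x^-1.
Proof. by apply/esym/ginv_uniq; rewrite -gmulA gmulVK gmulVr. Qed.

Lemma geq_mulV x y : x^-1 * y = 1 -> x = y.
Proof. by move=> /ginv_uniq ->; rewrite ginvK. Qed.

End Basics.

(* Normal form in the free group on the atoms of a term. *)
Ltac gnorm := rewrite /gcomm ?(ginvM, ginvK, ginv1, gmul1, gmul1r);
  rewrite -?gmulA ?(gmulKV, gmulVK, gmulV, gmulVr, gmul1, gmul1r).

Section Powers.
Variable G : grp.
Implicit Types x y z : G.

Lemma gpowD x m n : x ^+ (m + n) = x ^+ m * x ^+ n.
Proof. by elim: m => [|m IH]; rewrite ?gmul1 // addSn /= IH gmulA. Qed.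

Lemma gpowSr x n : x ^+ n.+1 = x ^+ n * x.
Proof. by rewrite -addn1 gpowD /= gmul1r. Qed.

Lemma gpowM x m n : x ^+ (m * n) = (x ^+ m) ^+ n.
Proof. by elim: n => [|n IH] /=; rewrite ?muln0 // mulnS gpowD IH. Qed.

Lemma gpow1n n : (1 : G) ^+ n = 1.
Proof. by elim: n => //= n ->; rewrite gmul1. Qed.

Lemma gcommute_pow x y n : x * y = y * x -> x ^+ n * y = y * x ^+ n.
Proof. by move=> e; elim: n => [|n IH] /=; rewrite ?gmul1 ?gmul1r // -gmulA IH gmulA e gmulA. Qed.

Lemma gpowMn x y n : x * y = y * x -> (x * y) ^+ n = x ^+ n * y ^+ n.
Proof.
move=> e; elim: n => [|n IH] /=; first by rewrite gmul1.
by rewrite IH -!gmulA; congr (_ * _); rewrite !gmulA (gcommute_pow n e).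
Qed.

Lemma gpowV x n : x^-1 ^+ n = (x ^+ n)^-1.
Proof. by elim: n => [|n IH]; rewrite ?ginv1 // gpowSr IH /= ginvM. Qed.

Lemma gcommuteV x y : x * y = y * x -> x^-1 * y = y * x^-1.
Proof. by move=> e; apply: (@gmulI _ x); rewrite gmulVK gmulA e -gmulA gmulVr gmul1r. Qed.

Definition zpow x (k : int) : G :=
  match k with Posz n => x ^+ n | Negz n => (x ^+ n.+1)^-1 end.

Lemma zpowS x k : zpow x (k + 1)%R = zpow x k * x.
Proof.
case: k => [n|n]; first by rewrite -PoszD addn1 -gpowSr.
case: n => [|n]; first by rewrite /= gmul1r gmulV.
have -> : (Negz n.+1 + 1)%R = Negz n by lia.
by change ((x ^+ n.+1)^-1 = (x * x ^+ n.+1)^-1 * x); rewrite ginvM -gmulA gmulV gmul1r.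
Qed.

Lemma zpowP x k : zpow x (k - 1)%R = zpow x k * x^-1.
Proof. by have := zpowS x (k - 1)%R; rewrite GRing.subrK => ->; rewrite -gmulA gmulVr gmul1r. Qed.

Lemma zpowD x k l : zpow x (k + l)%R = zpow x k * zpow x l.
Proof.
elim: l => [|n IH|n IH]; first by rewrite GRing.addr0 gmul1r.
- have -> : (n.+1 = n%:Z + 1 :> int)%R by lia.
  by rewrite GRing.addrA !zpowS IH gmulA.
- have -> : (- n.+1%:Z = - n%:Z - 1 :> int)%R by lia.
  by rewrite GRing.addrA !zpowP IH gmulA.
Qed.

Lemma zpowN x k : zpow x (- k)%R = (zpow x k)^-1.
Proof. by apply: ginv_uniq; rewrite -zpowD GRing.subrr. Qed.

Lemma zpowMn x k n : zpow x (k * n%:Z)%R = (zpow x k) ^+ n.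
Proof.
elim: n => [|n IH]; first by rewrite GRing.mulr0.
have -> : (k * n.+1%:Z = k * n%:Z + k)%R by lia.
by rewrite zpowD IH gpowSr.
Qed.

Lemma zpowM x k l : zpow x (k * l)%R = zpow (zpow x k) l.
Proof.
case: l => n; first by rewrite zpowMn.
by rewrite NegzE GRing.mulrN !zpowN zpowMn.
Qed.

End Powers.

Section Subgroups.
Variable G : grp.
Implicit Types (x y z : G) (S N T : G -> Prop).

Lemma sub1 S : is_subgroup S -> S 1. Proof. by case. Qed.
Lemma subM S x y : is_subgroup S -> S x -> S y -> S (x * y). Proof. by case=> _ + _; apply. Qed.
Lemma subV S x : is_subgroup S -> S x -> S x^-1. Proof. by case=> _ _; apply. Qed.
Lemma subX S x n : is_subgroup S -> S x -> S (x ^+ n).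
Proof. by move=> sS Sx; elim: n => [|n IH] /=; [apply: sub1 | apply: subM]. Qed.
Lemma subZ S x k : is_subgroup S -> S x -> S (zpow x k).
Proof. by case: k => n sS Sx; [apply: subX | apply: subV => //; apply: subX]. Qed.
Lemma sub_cancel S x y : is_subgroup S -> S x -> S (x * y) -> S y.
Proof. by move=> sS Sx Sxy; rewrite -(gmulKV x y); apply: subM => //; apply: subV. Qed.

Definition gnormal N := forall x y, N x -> N (y^-1 * x * y).

Lemma gen_sub S : is_subgroup (gen S).
Proof.
split=> [P sP _|x y gx gy P sP SP|x gx P sP SP].
- exact: sub1.
- by apply: subM => //; [apply: gx | apply: gy].
- by apply: subV => //; apply: gx.
Qed.

Lemma gen_in S x : S x -> gen S x. Proof. by move=> Sx P _; apply. Qed.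

End Subgroups.

(** * Finitely generated nilpotent groups *)

Section LowerCentral.
Variable G : grp.
Implicit Types (x y z : G) (S N T : G -> Prop).
Local Notation gam := (@lcs G).

Lemma lcs_sub n : is_subgroup (gam n).
Proof. by case: n => [|n] //; apply: gen_sub. Qed.

Lemma lcs_comm n x y : gam n x -> gam n.+1 (gcomm x y).
Proof. by move=> gx; apply: gen_in; exists x, y. Qed.

Lemma lcsS n x : gam n.+1 x -> gam n x.
Proof.
elim: n x => [//|n IH] x; apply; first exact: lcs_sub.
by move=> _ [u [v [/IH gu ->]]]; apply: lcs_comm.
Qed.

(** Conjugation changes [x] only by [gcomm x y], which lies in the next term; hence every subgroup
    between two consecutive terms is normal. *)
Lemma lcs_between n T : is_subgroup T -> (forall x, gam n.+1 x -> T x) ->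
  forall x y, gam n x -> T x -> T (y^-1 * x * y).
Proof.
move=> sT gT x y gx Tx; have -> : y^-1 * x * y = x * gcomm x y by gnorm.
apply: subM => //; apply: gT; exact: lcs_comm.
Qed.

(** Generation of a factor of the lower central series, with the quotient replaced by a
    quantification over the subgroups [T] containing the next term. *)
Definition fin_mod n (l : seq G) :=
  (forall i, i < size l -> gam n (nth 1 l i)) /\
  forall T, is_subgroup T -> (forall x, gam n.+1 x -> T x) ->
    (forall i, i < size l -> T (nth 1 l i)) -> forall x, gam n x -> T x.

(** Modulo one term further, the commutator is multiplicative in each argument, so commutators of
    generators of one factor with generators of [G] generate the next factor. *)
Lemma lcs_fin_mod n : fin_generated G -> exists l, fin_mod n l.
Proof.
case=> [m [f genf]]; elim: n => [|n [l [ln lT]]].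
  exists [seq f i | i <- enum 'I_m]; split=> // T sT _ fT x _.
  apply: genf => // _ [i ->].
  by have := fT i; rewrite size_map size_enum_ord (nth_map i) ?size_enum_ord // nth_ord_enum; apply.
pose l' := [seq (gcomm x (f i)) | x <- l, i <- enum 'I_m].
have l'P P : (forall i, i < size l' -> P (nth 1 l' i)) <->
    (forall i j, i < size l -> P (gcomm (nth 1 l i) (f j))).
  rewrite /l'; elim: l {ln lT l'} => [|x l IH] /=; first by split.
  split=> [h [|i] j|h i].
  - move=> _ /=; have := h j; rewrite size_cat size_map size_enum_ord nth_cat size_map.
    rewrite size_enum_ord ltn_ord (nth_map j) ?size_enum_ord // nth_ord_enum; apply.
    by rewrite ltn_addr.
  - rewrite ltnS /=; move: i j; apply/IH => i il.
    have := h (m + i); rewrite size_cat nth_cat size_map size_enum_ord ltn_add2l il.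
    by rewrite ltnNge leq_addr /= addKn; apply.
  - rewrite size_cat nth_cat size_map size_enum_ord => il; case: ltnP => im.
      rewrite (nth_map (Ordinal im)) ?size_enum_ord // (nth_ord_enum _ (Ordinal im)).
      exact: (h 0).
    rewrite -ltn_subLR // in il; move: (i - m) il; apply/IH => k j kl.
    exact: (h k.+1).
exists l'; split.
  by apply/(l'P (gam n.+1)) => i j il; apply: lcs_comm; apply: ln.
move=> T sT gT /(l'P T) lT' x gx.
have TJ u y : gam n.+1 u -> T u -> T (y^-1 * u * y) by apply: lcs_between.
apply: gx => // _ [u [v [gu ->]]].
(* Multiplicativity in the first argument: the [u] with [gcomm u (f j)] in [T] form a subgroup, to
   which the induction hypothesis on [l] applies. *)
have Hf : forall j u, gam n u -> T (gcomm u (f j)).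
  move=> j {gu}u gu.
  suff [] : gam n u /\ T (gcomm u (f j)) by [].
  apply: (lT (fun u => gam n u /\ T (gcomm u (f j)))) => //.
  - have sg := lcs_sub n.
    split=> [|a b [ga Ta] [gb Tb]|a [ga Ta]].
    + by split; [apply: sub1 | gnorm; apply: sub1].
    + split; first exact: subM.
      have -> : gcomm (a * b) (f j) = (b^-1 * (gcomm a (f j)) * b) * (gcomm b (f j)) by gnorm.
      by apply: subM => //; apply: TJ => //; apply: lcs_comm.
    + split; first exact: subV.
      have -> : gcomm a^-1 (f j) = (a^-1^-1 * (gcomm a (f j))^-1 * a^-1) by gnorm.
      by apply: TJ; [apply: (@subV _ (gam n.+1)); [apply: lcs_sub|apply: lcs_comm] | apply: subV].
  - by move=> y gy; split; [apply: lcsS | apply: gT; apply: lcs_comm].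
  - by move=> i il; split; [apply: ln | apply: lT'].
apply: (genf v (fun v => T (gcomm u v))); last by move=> _ [j ->]; apply: Hf.
split=> [|a b Ta Tb|a Ta].
- by gnorm; apply: sub1.
- have -> : gcomm u (a * b) = (gcomm u b) * (b^-1 * (gcomm u a) * b) by gnorm.
  by apply: subM => //; apply: TJ => //; apply: lcs_comm.
- have -> : gcomm u a^-1 = (a^-1^-1 * (gcomm u a)^-1 * a^-1) by gnorm.
  by apply: TJ; [apply: (@subV _ (gam n.+1)); [apply: lcs_sub|apply: lcs_comm] | apply: subV].
Qed.

Definition ext_by N x y := exists k, N ((zpow x k)^-1 * y).

(** Each step adjoins one element. The set [S] is merely covered by the cosets of [N] by powers of
    [x], so the property passes to subsets. *)
Inductive polycyclic : (G -> Prop) -> Prop :=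
| Poly1 N : (forall x, N x -> x = 1) -> polycyclic N
| PolyS N S x : polycyclic N -> is_subgroup N -> gnormal N ->
    (forall y, S y -> ext_by N x y) -> polycyclic S.

Lemma ext_sub N x : is_subgroup N -> gnormal N -> is_subgroup (ext_by N x).
Proof.
move=> sN nN; split.
- by exists 0%R; gnorm; apply: sub1.
- move=> y z [k Nk] [l Nl]; exists (k + l)%R; rewrite zpowD.
  have -> : (zpow x k * zpow x l)^-1 * (y * z) =
     ((zpow x l)^-1 * ((zpow x k)^-1 * y) * zpow x l) * ((zpow x l)^-1 * z) by gnorm.
  by apply: subM => //; apply: nN.
- move=> y [k Nk]; exists (- k)%R; rewrite zpowN.
  have -> : (zpow x k)^-1^-1 * y^-1 = (zpow x k)^-1^-1 * ((zpow x k)^-1 * y)^-1 * (zpow x k)^-1 by gnorm.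
  by apply: nN; apply: subV.
Qed.

(** The lower central series is refined by adjoining the generators of a factor one at a time; the
    intermediate subgroups are normal by [lcs_between]. *)
Lemma polycyclic_nilpotent : fin_generated G -> nilpotent_grp G -> polycyclic (fun _ : G => True).
Proof.
move=> fG [c gc].
suff H : forall d, d <= c -> polycyclic (gam (c - d)) by have := H c; rewrite subnn; apply.
elim=> [|d IH] dc; first by rewrite subn0; apply: Poly1.
have {}IH := IH (ltnW dc); set n := c - d.+1.
have en : c - d = n.+1 by rewrite /n; lia.
rewrite {}en in IH.
have [l [ln lT]] := lcs_fin_mod n fG.
suff H : forall m, m <= size l -> exists T, [/\ polycyclic T, is_subgroup T,
    (forall x, gam n.+1 x -> T x), (forall x, T x -> gam n x) &
    (forall i, i < m -> T (nth 1 l i))].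
  have [T [pT sT gT Tg Tl]] := H _ (leqnn _).
  apply: (@PolyS T _ 1) => //; last first.
    by move=> y gy; exists 0%R; gnorm; apply: lT.
  by move=> x y Tx; apply: (@lcs_between n) => //; apply: Tg.
elim=> [|m IHm] ml.
  exists (gam n.+1); split=> //; [exact: lcs_sub | exact: lcsS].
have [T [pT sT gT Tg Tl]] := IHm (ltnW ml).
have nT : gnormal T by move=> x y Tx; apply: (@lcs_between n) => //; apply: Tg.
exists (ext_by T (nth 1 l m)); split.
- exact: (@PolyS T _ (nth 1 l m)).
- exact: ext_sub.
- by move=> x gx; exists 0%R; gnorm; apply: gT.
- move=> x [k Tk]; rewrite -(gmulVK (zpow (nth 1 l m) k) x).
  have sg := lcs_sub n.
  by apply: subM => //; [apply: subZ => //; apply: ln | apply: Tg].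
- move=> i; rewrite ltnS leq_eqVlt => /orP[/eqP->|im].
    by exists 1%R; rewrite /= gmul1r gmulV; apply: sub1.
  by exists 0%R; gnorm; apply: Tl.
Qed.

End LowerCentral.

(** * Ascending chains and finiteness in polycyclic groups *)

Section Chains.
Variable G : grp.
Implicit Types (x y z : G) (S N T : G -> Prop).

Definition chain (C : nat -> G -> Prop) :=
  (forall i, is_subgroup (C i)) /\ (forall i x, C i x -> C i.+1 x).

Lemma chain_mono C i j x : chain C -> i <= j -> C i x -> C j x.
Proof.
move=> [_ CS] /subnK <-; elim: (j - i) => // n IH /IH; rewrite addSn; exact: CS.
Qed.

Definition acc_on S := forall C, chain C ->
  exists n, forall m x, n <= m -> C m x -> S x -> C n x.

(* A chain in [S = <x>N] is determined by its traces on [N] and on the exponents of [x]; once the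
   smallest positive exponent has appeared, the latter are stationary. *)
Lemma polycyclic_acc S : polycyclic S -> acc_on S.
Proof.
elim=> {S} [N N1|N S x _ IH sN nN SN] C cC.
  by exists 0 => m y _ _ /N1 ->; apply: sub1; case: cC.
have [n1 n1P] := IH C cC.
(* [T i] is the product of [C i] and [N]: it records which cosets of [N] the chain has reached. *)
pose T i y := exists u, N u /\ C i (y * u).
have sC i : is_subgroup (C i) by case: cC.
have sT i : is_subgroup (T i).
  split=> [|y z [u [Nu Cu]] [v [Nv Cv]]|y [u [Nu Cu]]].
  - by exists 1; split; gnorm; apply: sub1.
  - exists (z^-1 * u * z * v); split; first by apply: subM => //; apply: nN.
    have -> : y * z * (z^-1 * u * z * v) = (y * u) * (z * v) by gnorm.
    exact: subM.
  - exists (y^-1^-1 * u^-1 * y^-1); split; first by apply: nN; apply: subV.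
    have -> : y^-1 * (y^-1^-1 * u^-1 * y^-1) = (y * u)^-1 by gnorm.
    exact: subV.
have TC i j y : i <= j -> T i y -> T j y.
  by move=> ij [u [Nu Cu]]; exists u; split=> //; apply: chain_mono Cu.
have [n2 n2P] : exists n2, forall m k, n2 <= m -> T m (zpow x k) -> T n2 (zpow x k).
  pose P g := `[< 0 < g /\ exists i, T i (x ^+ g) >].
  have [exP|noP] := pselect (exists g, P g); last first.
    exists 0 => m k _ Tk; suff -> : k = 0%R by apply: sub1.
    apply: contrapT => k0; apply: noP; exists `|k|%N; apply/asboolP; split; first by lia.
    exists m; case: k Tk k0 => n Tn _ //; rewrite NegzE in Tn.
    by rewrite -(ginvK (_ ^+ _)); apply: subV => //; move: Tn; rewrite zpowN.
  case: (ex_minnP exP) => g /asboolP[g0 [n Tg]] gmin; exists n => m k nm Tk.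
  have ke := divz_eq k g%:Z.
  have Tq j q : T j (x ^+ g) -> T j (zpow x (q * g%:Z)%R).
    by move=> Tj; rewrite GRing.mulrC zpowM; apply: subZ.
  have r0 : (k %% g%:Z)%Z = 0%R.
    apply: contrapT => r0.
    have rg : (`|(k %% g%:Z)%Z| < g)%N by have := ltz_pmod k (_ : (0 < g%:Z)%R); have := modz_ge0 k (_ : Posz g != 0%R); lia.
    have rz : (k %% g%:Z)%Z = `|(k %% g%:Z)%Z|%N by have := modz_ge0 k (_ : Posz g != 0%R); lia.
    have : g <= `|(k %% g%:Z)%Z|.
      apply: gmin; apply/asboolP; split; first by lia.
      exists m; have -> : x ^+ `|(k %% g%:Z)%Z| = zpow x (k %% g%:Z)%Z by rewrite {2}rz.
      move: Tk; rewrite {1}ke zpowD; apply: sub_cancel => //.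
      by apply: Tq; apply: TC Tg.
    lia.
  by rewrite ke r0 GRing.addr0; apply: Tq.
exists (maxn n1 n2) => m y nm Cy Sy.
have [k Nk] := SN _ Sy.
have := n2P m k (leq_trans (leq_maxr _ _) nm).
case=> [|u [Nu Cu]]; first by exists ((zpow x k)^-1 * y); split; gnorm.
(* Modular law: [zpow x k * u] is already in the chain, and what remains of [y] lies in [N], where
   the chain is stationary. *)
rewrite -(gmulVK (zpow x k * u) y).
have Cu' : C (maxn n1 n2) (zpow x k * u) by apply: chain_mono Cu => //; apply: leq_maxr.
apply: subM => //.
apply: (@chain_mono _ n1) => //; first exact: leq_maxl.
apply: (n1P m); first exact: leq_trans (leq_maxl _ _) nm.
- by apply: subM => //; apply: subV => //; apply: chain_mono Cu'.
- by gnorm; apply: subM => //; apply: subV.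
Qed.

(** Exponents of the adjoined element can be reduced modulo [m], so each step multiplies the size by
    at most [m]. *)
Lemma polycyclic_finite S m : polycyclic S -> 0 < m -> (forall x, x ^+ m = 1) ->
  exists (I : finType) (f : I -> G), forall y, S y -> exists i, y = f i.
Proof.
move=> pS m0 xm; elim: pS => {S} [N N1|N S x _ [I [f fI]] sN nN SN].
  by exists unit, (fun=> 1) => y /N1 ->; exists tt.
exists ('I_m * I)%type, (fun i : 'I_m * I => x ^+ i.1 * f i.2) => y /SN[k /fI[i yi]].
have r0 : (0 <= (k %% m%:Z)%Z)%R by apply: modz_ge0; lia.
have rm : (`|(k %% m%:Z)%Z| < m)%N by have := ltz_pmod k (_ : (0 < m%:Z)%R); lia.
exists (Ordinal rm, i) => /=; rewrite -yi -[LHS](gmulVK (zpow x k)); congr (_ * _).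
rewrite {1}(divz_eq k m%:Z) zpowD zpowMn xm gmul1.
by have -> : (k %% m%:Z)%Z = `|(k %% m%:Z)%Z|%N by lia.
Qed.

End Chains.

(** * Homomorphisms and quotient groups *)

Section Homs.
Variables (G L : grp) (f : G -> L).
Hypothesis fM : is_hom f.

Lemma hom1 : f 1 = 1.
Proof. by apply: (@gmulI _ (f 1)); rewrite -fM !gmul1r. Qed.
Lemma homV x : f x^-1 = (f x)^-1.
Proof. by apply: ginv_uniq; rewrite -fM gmulVr hom1. Qed.
Lemma homX x n : f (x ^+ n) = f x ^+ n.
Proof. by elim: n => [|n IH] /=; rewrite ?hom1 // fM IH. Qed.
Lemma hom_comm x y : f (gcomm x y) = (gcomm (f x) (f y)).
Proof. by rewrite /gcomm !fM !homV. Qed.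

Lemma preim_sub S : is_subgroup S -> is_subgroup (fun x => S (f x)).
Proof.
move=> sS; split=> [|x y Sx Sy|x Sx]; rewrite ?hom1 ?fM ?homV.
- exact: sub1.
- exact: subM.
- exact: subV.
Qed.

Lemma preim_normal S : gnormal S -> gnormal (fun x => S (f x)).
Proof. by move=> nS x y Sx; rewrite !fM homV; apply: nS. Qed.

Lemma preim_isolated p S : pprime_isolated p S -> pprime_isolated p (fun x => S (f x)).
Proof. by move=> iS q pq qp y; rewrite homX; apply: iS. Qed.

Hypothesis f_onto : forall y, exists x, f x = y.

Lemma onto_fin_generated : fin_generated G -> fin_generated L.
Proof.
move=> [n [g gen_g]]; exists n, (f \o g) => y; have [x <-] := f_onto y.
move=> P sP gP; apply: (gen_g x (fun x => P (f x))); first exact: preim_sub.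
by move=> _ [i ->]; apply: gP; exists i.
Qed.

Lemma onto_nilpotent : nilpotent_grp G -> nilpotent_grp L.
Proof.
move=> [c gc]; exists c => y.
suff H n : forall z, @lcs L n z -> exists2 x, @lcs G n x & f x = z.
  by move=> /H[x /gc -> <-]; apply: hom1.
elim: n => [|n IH] z; first by have [x <-] := f_onto z; exists x.
move=> gz; apply: (gz (fun z => exists2 x, @lcs G n.+1 x & f x = z)).
  have sg := @lcs_sub G n.+1; split=> [|u v [x gx <-] [x' gx' <-]|u [x gx <-]].
  - by exists 1; [apply: (sub1 sg) | apply: hom1].
  - by exists (x * x'); [apply: (subM sg) | rewrite fM].
  - by exists x^-1; [apply: (subV sg) | rewrite homV].
move=> _ [u [v [/IH[x gx <-] ->]]]; have [x' <-] := f_onto v.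
by exists (gcomm x x'); [apply: lcs_comm | rewrite hom_comm].
Qed.

End Homs.

Section Quotient.
Variables (G : grp) (N : G -> Prop).
Hypotheses (sN : is_subgroup N) (nN : gnormal N).

(** Cosets are predicates, so that extensionality turns equivalence into equality; the operations go
    through chosen representatives. *)
Let coset x := fun y => N (x^-1 * y).

Let cosetE x y : N (x^-1 * y) -> coset x = coset y.
Proof.
move=> Nxy; apply: funext => z; apply: propext; rewrite /coset; split=> h.
- have -> : y^-1 * z = (x^-1 * y)^-1 * (x^-1 * z) by gnorm.
  by apply: subM => //; apply: subV.
- have -> : x^-1 * z = (x^-1 * y) * (y^-1 * z) by gnorm.
  exact: subM.
Qed.

Let qcar := {P : G -> Prop | exists x, P = coset x}.
Let pi x : qcar := exist _ (coset x) (ex_intro _ x erefl).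
Let rep (P : qcar) : G := sval (cid (svalP P)).

Let piE x y : pi x = pi y <-> N (x^-1 * y).
Proof.
split=> [[e]|/cosetE e]; last by apply: eq_exist.
have : coset y y by rewrite /coset gmulV; apply: sub1.
by rewrite -e.
Qed.

Let repK P : pi (rep P) = P.
Proof. by case: P => P HP; apply: eq_exist; rewrite /rep; case: cid => x /= ->. Qed.

Let qmul P Q := pi (rep P * rep Q).
Let qinv P := pi (rep P)^-1.

Let piM x y : qmul (pi x) (pi y) = pi (x * y).
Proof.
have /piE h1 := repK (pi x); have /piE h2 := repK (pi y); apply/piE.
set a := rep _ in h1 *; set b := rep _ in h2 *.
have -> : (a * b)^-1 * (x * y) = (b^-1 * (a^-1 * x) * b) * (b^-1 * y) by gnorm.
by apply: subM => //; apply: nN.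
Qed.

Let piV x : qinv (pi x) = pi x^-1.
Proof.
have /piE h := repK (pi x); apply/piE; set a := rep _ in h *.
have -> : a^-1^-1 * x^-1 = a^-1^-1 * (a^-1 * x)^-1 * a^-1 by gnorm.
by apply: nN; apply: subV.
Qed.

Lemma quotient_exists : exists (W : grp) (f : G -> W),
  [/\ is_hom f, (forall w, exists x, f x = w) & (forall x, f x = 1 <-> N x)].
Proof.
have qA P Q R : qmul P (qmul Q R) = qmul (qmul P Q) R.
  by rewrite -(repK P) -(repK Q) -(repK R) !piM gmulA.
have q1 P : qmul (pi 1) P = P by rewrite -(repK P) piM gmul1.
have qV P : qmul (qinv P) P = pi 1 by rewrite -(repK P) piV piM gmulV.
exists (Grp qA q1 qV), pi; split=> [x y|w|x] /=; first by rewrite piM.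
- by exists (rep w); apply: repK.
- split=> [/esym/piE|Nx]; first by gnorm.
  by apply/esym/piE; gnorm.
Qed.

End Quotient.

(** * Finite p-quotients *)

Definition pquot (p : nat) (G : grp) (gT : finGroupType) (psi : G -> gT) :=
  [/\ (forall x y, psi (x * y) = (psi x * psi y)%g), (forall z, exists x, psi x = z) &
      (p.-group [set: gT])%g].

Lemma pgroup_elements p (gT : finGroupType) (X : {group gT}) : prime p ->
  (forall x, x \in X -> exists n, (x ^+ (p ^ n) = 1)%g) -> (p.-group X)%g.
Proof.
move=> pp h; apply/pgroupP => q pq qX.
have [x xX ox] := Cauchy pq qX; have [n xn] := h x xX.
have : q %| p ^ n by rewrite -ox order_dvdn xn.
by rewrite Euclid_dvdX // dvdn_prime2 // => /andP[/eqP -> _]; rewrite inE.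
Qed.

(** Restricting to the image restores surjectivity and leaves only the orders of its elements to be
    checked. The target may thus be any finite group, such as a group of invertible matrices. *)
Lemma pquot_image p (G : grp) (gT : finGroupType) (psi : G -> gT) : prime p ->
  (forall x y, psi (x * y) = (psi x * psi y)%g) ->
  (forall x, exists n, (psi x ^+ (p ^ n) = 1)%g) ->
  exists (gT' : finGroupType) (psi' : G -> gT'),
    pquot p psi' /\ forall x y, psi' x = psi' y <-> psi x = psi y.
Proof.
move=> pp psiM psin.
pose X := [set z : gT | `[< exists x, psi x = z >]].
have XP z : reflect (exists x, psi x = z) (z \in X) by rewrite inE; apply: asboolP.
have psi1 : psi 1 = 1%g by apply: (mulgI (psi 1)); rewrite -psiM gmul1 mulg1.
have gX : group_set X.
  apply/group_setP; split; first by apply/XP; exists 1.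
  by move=> _ _ /XP[x <-] /XP[y <-]; apply/XP; exists (x * y).
pose XG := Group gX.
have psiX x : psi x \in XG by apply/XP; exists x.
exists (subg_of XG), (fun x => subg XG (psi x)); split; first split.
- by move=> x y; rewrite psiM subgM.
- move=> z; have /XP[x xz] := subgP z.
  by exists x; rewrite xz sgvalK.
- apply: pgroup_elements => // z _; have /XP[x xz] := subgP z.
  have [n xn] := psin x; exists n; apply: val_inj.
  by have := morphX (sgval_morphism XG) (p ^ n) (in_setT z) => /= ->; rewrite -xz xn.
- move=> x y; split=> [e|-> //].
  by rewrite -(@subgK _ XG _ (psiX x)) -(@subgK _ XG _ (psiX y)) e.
Qed.

(** Cayley's theorem: [G] acts faithfully by right translation on the finite set of values of
    [c]. *)
Lemma finite_pquot p (G : grp) (I : finType) (c : G -> I) : prime p -> injective c ->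
  (forall x : G, exists n, x ^+ (p ^ n) = 1) ->
  exists (gT : finGroupType) (psi : G -> gT), pquot p psi /\ injective psi.
Proof.
move=> pp cI xp.
pose J := {i : I | `[< exists x, c x = i >]}.
have cJ x : `[< exists y, c y = c x >] by apply/asboolP; exists x.
pose d x : J := exist _ (c x) (cJ x).
have d_onto (j : J) : exists x, d x = j.
  by case: j => i iP; have [x xi] := asboolW iP; exists x; apply: val_inj.
have [e eK] := choice d_onto.
have dI : injective d by move=> x y [/cI].
have dK : cancel d e by move=> x; apply: dI; rewrite eK.
have actI x : injective (fun j => d (e j * x)).
  move=> j k /dI h; rewrite -(eK j) -(eK k); congr d.
  by rewrite -(gmul1r (e j)) -(gmul1r (e k)) -(gmulVr x) !gmulA h.
pose psi x : {perm J} := perm (actI x).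
have psiM x y : psi (x * y) = (psi x * psi y)%g.
  by apply/permP => j; rewrite permM !permE dK gmulA.
have psiI : injective psi.
  move=> x y /permP/(_ (d 1)); rewrite !permE !dK !gmul1; exact: dI.
have psi1 : psi 1 = 1%g by apply: (mulgI (psi 1)); rewrite -psiM gmul1 mulg1.
have psiX x n : psi (x ^+ n) = (psi x ^+ n)%g.
  by elim: n => [|n IH]; rewrite ?psi1 // expgS -IH -psiM.
have [|gT [psi' [qpsi psiE]]] := pquot_image pp psiM.
  by move=> x; have [n xn] := xp x; exists n; rewrite -psiX xn.
by exists gT, psi'; split=> // x y /psiE/psiI.
Qed.

(** * Residual p-finiteness *)

Section Isolated.
Variables (p : nat) (G : grp).
Hypothesis pp : prime p.
Implicit Types (x y z : G) (S N T : G -> Prop).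

Lemma isolated_coprime N r y : pprime_isolated p N -> coprime p r -> N (y ^+ r) -> N y.
Proof.
move=> iN; elim/ltn_ind: r y => r IH y pr Nr.
case: (posnP r) => [r0|r_gt0].
  by move: pr; rewrite r0 /coprime gcdn0 => /eqP p1; have := pp; rewrite p1.
case: (leqP r 1) => r1.
  have e1 : r = 1%N by apply/eqP; rewrite eqn_leq r1.
  by move: Nr; rewrite e1 /= gmul1r.
have qP := pdiv_prime r1; have qr := pdiv_dvd r.
have re : r = (r %/ pdiv r * pdiv r)%N by rewrite divnK.
apply: (IH (r %/ pdiv r)).
- by rewrite ltn_Pdiv ?prime_gt1.
- by apply: coprime_dvdr pr; apply: dvdn_div.
- apply: (iN (pdiv r)) => //; last by rewrite -gpowM -re.
  apply/eqP => qp; move: pr; rewrite prime_coprime // -{1}qp qr //.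
Qed.

Definition gcenter x := forall g : G, x * g = g * x.

Lemma center_sub : is_subgroup gcenter.
Proof.
split=> [g|x y cx cy g|x cx g]; first by gnorm.
- by rewrite -gmulA cy gmulA cx -gmulA.
- by apply: gcommuteV.
Qed.

Lemma gcomm1P x y : gcomm x y = 1 <-> x * y = y * x.
Proof.
split=> [e|e]; last by rewrite /gcomm -[x^-1 * y^-1]ginvM -e -gmulA gmulV.
have -> : x * y = (y * x) * gcomm x y by gnorm.
by rewrite e gmul1r.
Qed.

Lemma gcommXl x y n : x * gcomm x y = gcomm x y * x -> gcomm (x ^+ n) y = gcomm x y ^+ n.
Proof.
move=> e; elim: n => [|n IH]; first by rewrite /=; gnorm.
have -> : gcomm (x ^+ n.+1) y = ((x ^+ n)^-1 * gcomm x y * x ^+ n) * gcomm (x ^+ n) y by rewrite /=; gnorm.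
by rewrite IH -(gmulA _ (gcomm x y)) -(gcommute_pow n e) gmulKV.
Qed.

Hypotheses (nilG : nilpotent_grp G) (tfG : pprime_isolated p (fun x : G => x = 1)).

(* Descending along the lower central series: if [x] commutes with [gamma_(n+1)], then
   [[x, g]^q = [x^q, g]] for [g] in [gamma_n]. *)
Lemma center_isolated : pprime_isolated p gcenter.
Proof.
move=> q qP qp x cx; case: nilG => c gc.
suff H d : d <= c -> forall g, @lcs G (c - d) g -> x * g = g * x.
  by move=> g; apply: (H c) => //; rewrite subnn.
elim: d => [|d IH] dc g gg.
  by rewrite (gc g) ?gmul1 ?gmul1r // -(subn0 c).
have {}IH := IH (ltnW dc); have en : c - d = (c - d.+1).+1 by lia.
rewrite {}en in IH; move: (c - d.+1) IH gg => n IH gg.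
apply/gcomm1P/(tfG qP qp); rewrite -gcommXl; first by apply/gcomm1P.
apply: IH; have -> : gcomm x g = (gcomm g x)^-1 by gnorm.
by apply: (@subV _ (@lcs G n.+1)); [apply: lcs_sub | apply: lcs_comm].
Qed.

(** The p'-isolator of [S] cut down to the center; centrality makes it normal. *)
Definition isolator S z := gcenter z /\ exists r, coprime p r /\ S (z ^+ r).

Lemma isolator_sub S : is_subgroup S -> is_subgroup (isolator S).
Proof.
move=> sS; have sZ := center_sub; split.
- by split; [apply: (sub1 sZ) | exists 1%N; rewrite coprimen1 /= gmul1; split=> //; apply: sub1].
- move=> x y [cx [r [pr Sr]]] [cy [s [ps Ss]]]; split; first exact: (subM sZ).
  exists (r * s)%N; rewrite coprimeMr pr ps gpowMn //; split=> //.
  by apply: subM => //; [|rewrite mulnC]; rewrite gpowM; apply: subX.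
- move=> x [cx [r [pr Sr]]]; split; first exact: (subV sZ).
  by exists r; rewrite gpowV; split=> //; apply: subV.
Qed.

Lemma isolator_normal S : gnormal (isolator S).
Proof.
by move=> x y [cx Sx]; rewrite -gmulA cx gmulKV.
Qed.

Lemma isolator_isolated S : pprime_isolated p (isolator S).
Proof.
move=> q qP qp y [cy [r [pr Sr]]]; split; first exact: (center_isolated qP qp).
exists (q * r)%N; rewrite gpowM coprimeMr pr andbT; split=> //.
by rewrite prime_coprime // dvdn_prime2 // eq_sym.
Qed.

(** With [wmin], the element [w] lies in every nontrivial normal p'-isolated subgroup: [G] is
    monolithic with respect to these. *)
Variable w : G.
Hypothesis w1 : w <> 1.
Hypothesis wmin : forall M, is_subgroup M -> gnormal M -> pprime_isolated p M ->
  ~ M w -> forall x, M x -> x = 1.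

(* If [z] had infinite order, then [w] would lie in the isolator of [<z^(p^i)>] for every [i]. *)
Lemma monolith_center_torsion z : gcenter z -> exists e, z ^+ (p ^ e) = 1.
Proof.
move=> cz; apply: contrapT => noe.
have zinf n : z ^+ n = 1 -> n = 0%N.
  move=> zn; apply: contrapT => n0; apply: noe; exists (logn p n).
  have [|m pm nE] := @pfactor_coprime p n pp; first by lia.
  apply: (isolated_coprime tfG pm); by rewrite -gpowM mulnC -nE.
have zinfz k : zpow z k = 1 -> k = 0%R.
  case: k => n; first by move/zinf->.
  by move=> /(congr1 ginv); rewrite ginvK ginv1 => /zinf.
have sZ := center_sub.
have H i : exists r s, coprime p r /\ w ^+ r = zpow z (Posz (p ^ i) * s)%R.
  pose S x := exists s, x = zpow z (Posz (p ^ i) * s)%R.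
  have sS : is_subgroup S.
    split=> [|_ _ [s ->] [t ->]|_ [s ->]].
    - by exists 0%R; rewrite GRing.mulr0.
    - by exists (s + t)%R; rewrite GRing.mulrDr zpowD.
    - by exists (- s)%R; rewrite GRing.mulrN zpowN.
  have [[_ [r [pr [s ws]]]]|nw] := pselect (isolator S w); first by exists r, s.
  have := wmin (isolator_sub sS) (isolator_normal (S := S)) (isolator_isolated (S := S)) nw.
  move/(_ (z ^+ (p ^ i))) => e; case: noe; exists i; apply: e; split; first exact: (subX _ sZ).
  exists 1%N; rewrite coprimen1 /= gmul1r; split=> //; exists 1%R.
  by rewrite GRing.mulr1.
have [r0 [s0 [pr0 ws0]]] := H 0; rewrite expn0 GRing.mul1r in ws0.
have s00 : s0 = 0%R.
  (* With this [i], the power [p ^ i] exceeds the absolute value of [s0]; it also divides [s0],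
     because it divides [s0 * r] with [r] prime to [p]. So [s0] vanishes. *)
  pose i := `|s0|%N; have [r [s [pr ws]]] := H i.
  have e : (s0 * Posz r = Posz (p ^ i) * s * Posz r0)%R.
    apply/eqP; rewrite -GRing.subr_eq0; apply/eqP/zinfz.
    by rewrite zpowD zpowN !zpowMn -ws -ws0 -!gpowM mulnC gmulVr.
  have : (Posz (p ^ i) %| (s0 * Posz r)%R)%Z by rewrite e -GRing.mulrA dvdz_mulr.
  rewrite Gauss_dvdzl; last by rewrite coprimezE; apply: coprimeXl.
  move=> d; have : p ^ i %| i by exact: d.
  by have := ltn_expl i (prime_gt1 pp) => lti /dvdn_leq; rewrite /i in lti *; lia.
apply: w1; apply: (isolated_coprime tfG pr0).
by rewrite ws0 s00.
Qed.

Hypothesis polyG : polycyclic (fun _ : G => True).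

(** The central elements killed by [p ^ e] form an ascending chain in [e], so one exponent serves
    for the whole center. *)
Lemma monolith_center_exponent : exists e, forall z, gcenter z -> z ^+ (p ^ e) = 1.
Proof.
have sZ := center_sub.
pose C e z := gcenter z /\ z ^+ (p ^ e) = 1.
have cC : chain C.
  split=> [e|e z [cz ze]]; last by split=> //; rewrite expnSr gpowM ze gpow1n.
  split=> [|x y [cx xe] [cy ye]|x [cx xe]]; rewrite /C.
  - by rewrite gpow1n; split=> //; apply: (sub1 sZ).
  - by rewrite gpowMn // xe ye gmul1; split=> //; apply: (subM sZ).
  - by rewrite gpowV xe ginv1; split=> //; apply: (subV sZ).
have [n nP] := polycyclic_acc polyG cC; exists n => z cz.
have [e ze] := monolith_center_torsion cz.
have := @chain_mono _ _ e (maxn n e) z cC (leq_maxr _ _) (conj cz ze).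
by case/(nP _ _ (leq_maxl n e)).
Qed.

Fixpoint ucs (n : nat) : G -> Prop :=
  match n with
  | 0 => fun x => x = 1
  | n'.+1 => fun x => forall g, ucs n' (gcomm x g)
  end.

Lemma ucs_sub_normal n : is_subgroup (ucs n) /\ gnormal (ucs n).
Proof.
elim: n => [|n [sU nU]]; split.
- by split=> [|x y -> ->|x ->] //=; gnorm.
- by move=> x y /= ->; gnorm.
- split=> [g|x y ux uy g|x ux g] /=.
  + by gnorm; apply: (sub1 sU).
  + have -> : gcomm (x * y) g = (y^-1 * gcomm x g * y) * gcomm y g by gnorm.
    exact: (subM sU (nU _ _ (ux g)) (uy g)).
  + have -> : gcomm x^-1 g = x^-1^-1 * (gcomm x g)^-1 * x^-1 by gnorm.
    exact: (nU _ _ (subV sU (ux g))).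
- move=> x y ux g /=.
  have -> : gcomm (y^-1 * x * y) g = y^-1 * gcomm x (y * g * y^-1) * y by gnorm.
  exact: (nU _ _ (ux _)).
Qed.

(** An exponent of the center bounds every upper central factor: modulo [ucs n], the commutator with
    [g] turns powers of [x] into powers of [gcomm x g], which lies one step lower. *)
Lemma ucs_pow e : (forall z, gcenter z -> z ^+ (p ^ e) = 1) ->
  forall n x, ucs n.+1 x -> ucs n (x ^+ (p ^ e)).
Proof.
move=> ze; elim=> [|n IH] x ux; first by apply: ze => g; apply/gcomm1P; apply: ux.
have [sU nU] := ucs_sub_normal n.
have H g k : ucs n ((gcomm x g ^+ k)^-1 * gcomm (x ^+ k) g).
  elim: k => [|k IHk]; first by rewrite /=; gnorm; apply: sub1.
  set t := gcomm x g in IHk *; set u := _ * _ in IHk.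
  have -> : (t ^+ k.+1)^-1 * gcomm (x ^+ k.+1) g =
      ((t ^+ k)^-1 * gcomm t (x ^+ k) * t ^+ k) * u.
    by rewrite /u /= /t; gnorm.
  by apply: subM => //; apply: nU; apply: ux.
move=> g; rewrite -(gmulVK (gcomm x g ^+ (p ^ e)) (gcomm _ g)).
by apply: subM => //; apply: IH; apply: ux.
Qed.

(** A group of class [c] is exhausted by [c] steps of the upper central series, and each step costs
    a factor [p ^ e] in the exponent. *)
Lemma monolith_exponent : exists e, forall x : G, x ^+ (p ^ e) = 1.
Proof.
have [e ze] := monolith_center_exponent; case: nilG => c gc.
have U n : forall x, ucs n x -> x ^+ (p ^ (e * n)) = 1.
  elim: n => [|n IH] x; first by move=> /= ->; rewrite gpow1n.
  by move/(ucs_pow ze)/IH; rewrite mulnS expnD gpowM.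
exists (e * c)%N => x; apply: U.
suff H d : d <= c -> forall g, @lcs G (c - d) g -> ucs d g.
  by apply: (H c) => //; rewrite subnn.
elim: d => [|d IH] dc g gg; first by apply: gc; rewrite -(subn0 c).
move=> y; apply: IH; first exact: ltnW.
have -> : c - d = (c - d.+1).+1 by lia.
exact: lcs_comm.
Qed.

End Isolated.

(* Among the normal p'-isolated subgroups containing [C] but not [k] take a maximal one [N]:
   the quotient by [N] is then a finite p-group. *)
Lemma isolated_p_separable p (K : grp) (C : K -> Prop) k : prime p ->
  fin_generated K -> nilpotent_grp K ->
  is_subgroup C -> gnormal C -> pprime_isolated p C -> ~ C k ->
  exists (gT : finGroupType) (psi : K -> gT),
    [/\ pquot p psi, (forall x, C x -> psi x = 1%g) & psi k <> 1%g].
Proof.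
move=> pp fK nK sC nC iC Ck.
pose Fam N := [/\ is_subgroup N, gnormal N, pprime_isolated p N,
  (forall x, C x -> N x) & ~ N k].
have FC : Fam C by [].
have [N [FN Nmax]] : exists N, Fam N /\ forall M, Fam M ->
    (forall x, N x -> M x) -> forall x, M x -> N x.
  apply: contrapT => noN.
  (* Without a maximal member, each member has a strictly larger one, and iterating a choice of
     these yields a chain that never becomes stationary. *)
  have step (N : {N | Fam N}) : exists M : {N | Fam N},
      (forall x, sval N x -> sval M x) /\ exists x, sval M x /\ ~ sval N x.
    case: N => N FN /=; apply: contrapT => h; apply: noN; exists N; split=> // M FM NM x Mx.
    by apply: contrapT => Nx; apply: h; exists (exist _ M FM); split=> //; exists x.
  have [f fP] := choice step.
  pose D i := iter i f (exist _ C FC).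
  have cD : chain (fun i => sval (D i)).
    split=> [i|i x]; first by case: (svalP (D i)).
    by case: (fP (D i)) => h _; apply: h.
  have [n nP] := polycyclic_acc (polycyclic_nilpotent fK nK) cD.
  have [_ [x [Dx nDx]]] := fP (D n).
  by apply: nDx; apply: (nP n.+1).
have [sN nN iN CN Nk] := FN.
have [W [f [fM f_onto fN]]] := quotient_exists sN nN.
have fW := onto_fin_generated fM f_onto fK; have nW := onto_nilpotent fM f_onto nK.
have tf : pprime_isolated p (fun x : W => x = 1).
  move=> q qP qp y; have [x <-] := f_onto y; rewrite -homX // => /fN xq.
  by apply/fN; apply: (iN q).
have k1 : f k <> 1 by move/fN.
have pW := polycyclic_nilpotent fW nW.
(* A normal p'-isolated subgroup of the quotient missing [f k] pulls back to a member of [Fam] above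
   [N], hence to [N] itself; this is what [wmin] asks. *)
have [|e eP] := monolith_exponent pp nW tf k1 _ pW.
  move=> M sM nM iM Mk w; have [x <-] := f_onto w => Mx; apply/fN.
  apply: (Nmax (fun x => M (f x))) => //.
  - split; [exact: preim_sub | exact: preim_normal | exact: preim_isolated | | exact: Mk].
    by move=> y /CN/fN ->; apply: sub1.
  - by move=> y /fN ->; apply: sub1.
have pe0 : 0 < p ^ e by rewrite expn_gt0 prime_gt0.
have [I [g gI]] := polycyclic_finite pW pe0 eP.
have [c cP] := choice (fun y => gI y Logic.I).
have cI : injective c by move=> x y cxy; rewrite (cP x) (cP y) cxy.
have [|gT [psi [[psiM psi_onto pgT] psiI]]] := finite_pquot pp cI; first by exists e.
have psi1 : psi 1 = 1%g by apply: (mulgI (psi 1)); rewrite -psiM gmul1 mulg1.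
exists gT, (psi \o f); split; first split=> //.
- by move=> x y /=; rewrite fM psiM.
- by move=> z; have [w <-] := psi_onto z; have [x <-] := f_onto w; exists x.
- by move=> x /CN/fN /= ->.
- by rewrite /= -psi1 => /psiI.
Qed.

(** * Central products of finite p-groups *)

Definition fgrp (gT : finGroupType) : grp := Grp (@mulgA gT) (@mul1g gT) (@mulVg gT).

Section FiniteHoms.
Variables (G : grp) (gT : finGroupType) (psi : G -> gT).
Hypothesis psiM : forall x y, psi (x * y) = (psi x * psi y)%g.

Lemma fhom1 : psi 1 = 1%g.
Proof. by apply: (mulgI (psi 1)); rewrite -psiM gmul1 mulg1. Qed.
Lemma fhomV x : psi x^-1 = ((psi x)^-1)%g.
Proof. by apply: (mulgI (psi x)); rewrite -psiM gmulVr mulgV fhom1. Qed.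
Lemma fhomX x n : psi (x ^+ n) = (psi x ^+ n)%g.
Proof. by elim: n => [|n IH]; rewrite ?fhom1 // expgS -IH -psiM. Qed.
End FiniteHoms.

Lemma pgroup_exponent (p : nat) (gT : finGroupType) : (p.-group [set: gT])%g ->
  exists n, forall x : gT, (x ^+ (p ^ n) = 1)%g.
Proof.
move=> /p_natP[n nE]; exists n => x.
by rewrite -nE; apply: expg_cardG; rewrite inE.
Qed.

Lemma pgroup_prod (p : nat) (gT1 gT2 : finGroupType) : (p.-group [set: gT1])%g ->
  (p.-group [set: gT2])%g -> (p.-group [set: gT1 * gT2])%g.
Proof. by rewrite /pgroup !cardsT card_prod pnatM => -> ->. Qed.

Lemma trivial_pgroup (p : nat) : exists gT : finGroupType, (p.-group [set: gT])%g.
Proof.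
by exists (subg_of (1%G : {group {perm bool}})); rewrite /pgroup cardsT card_sub cards1.
Qed.

(** A direct product of quotients handles finitely many elements at once. Surjectivity is given up
    here and recovered on images later. *)
Lemma isolated_p_separable_fin p (K : grp) (C : K -> Prop) (I : finType) (k : I -> K) :
  prime p -> fin_generated K -> nilpotent_grp K ->
  is_subgroup C -> gnormal C -> pprime_isolated p C ->
  exists (gT : finGroupType) (psi : K -> gT),
    [/\ (forall x y, psi (x * y) = (psi x * psi y)%g), (p.-group [set: gT])%g,
        (forall x, C x -> psi x = 1%g) & (forall i, psi (k i) = 1%g -> C (k i))].
Proof.
move=> pp fK nK sC nC iC.
suff [gT [psi [psiM pgT psiC psik]]] : exists (gT : finGroupType) (psi : K -> gT),
    [/\ (forall x y, psi (x * y) = (psi x * psi y)%g), (p.-group [set: gT])%g,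
        (forall x, C x -> psi x = 1%g) &
        (forall i, i \in enum I -> psi (k i) = 1%g -> C (k i))].
  by exists gT, psi; split=> // i; apply: psik; rewrite mem_enum.
elim: (enum I) => [|i s [gT [psi [psiM pgT psiC psik]]]].
  have [gT pgT] := trivial_pgroup p.
  by exists gT, (fun=> 1%g); split=> // x y; rewrite mulg1.
have [Ci|nCi] := pselect (C (k i)).
  by exists gT, psi; split=> // j; rewrite inE => /predU1P[-> //|]; apply: psik.
have [gT' [psi' [[psiM' _ pgT'] psiC' psik']]] := isolated_p_separable pp fK nK sC nC iC nCi.
exists (gT * gT')%type, (fun x => (psi x, psi' x)); split.
- by move=> x y; rewrite psiM psiM'.
- exact: pgroup_prod.
- by move=> x Cx; rewrite psiC ?psiC'.
- move=> j; rewrite inE => /predU1P[-> [_ /psik' //]|js [h _]]; exact: psik.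
Qed.

(* [R] is the graph of the isomorphism [A -> B]: as a relation, it makes [H] and [K] interchangeable. *)
Record central_iso p (H K : grp) (R : H -> K -> Prop) : Prop := CentralIso {
  ci1 : R 1 1;
  ciM : forall a b a' b', R a b -> R a' b' -> R (a * a') (b * b');
  ciV : forall a b, R a b -> R a^-1 b^-1;
  ci_fun : forall a b b', R a b -> R a b' -> b = b';
  ci_inj : forall a a' b, R a b -> R a' b -> a = a';
  ci_centl : forall a b, R a b -> gcenter a;
  ci_centr : forall a b, R a b -> gcenter b;
  ci_isol : pprime_isolated p (fun a => exists b, R a b);
  ci_isor : pprime_isolated p (fun b => exists a, R a b) }.

Lemma central_iso_sym p (H K : grp) (R : H -> K -> Prop) :
  central_iso p R -> central_iso p (fun b a => R a b).
Proof.
by case=> *; split; eauto.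
Qed.

Lemma central_normal (G : grp) (C : G -> Prop) : (forall x, C x -> gcenter x) -> gnormal C.
Proof. by move=> cC x y Cx; rewrite -gmulA (cC _ Cx) gmulKV. Qed.

Definition prodg (H K : grp) : grp.
Proof.
refine (@Grp (H * K) (fun x y => (x.1 * y.1, x.2 * y.2)) (1, 1) (fun x => (x.1^-1, x.2^-1)) _ _ _).
- by move=> x y z; rewrite !gmulA.
- by case=> x y; rewrite !gmul1.
- by move=> x; rewrite !gmulV.
Defined.

Lemma prodgM (H K : grp) (x x' : H) (y y' : K) :
  ((x, y) : prodg H K) * ((x', y') : prodg H K) = ((x * x', y * y') : prodg H K).
Proof. by []. Qed.

Lemma prodgV (H K : grp) (x : H) (y : K) : ((x, y) : prodg H K)^-1 = ((x^-1, y^-1) : prodg H K).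
Proof. by []. Qed.

(** The data that extends to a homomorphism from the amalgam to a finite p-group in which the images
    of the two factors commute. *)
Definition central_pair (p : nat) (H K : grp) (R : H -> K -> Prop) (P : finGroupType)
    (al : H -> P) (be : K -> P) :=
  [/\ (forall x y, al (x * y) = (al x * al y)%g), (forall x y, be (x * y) = (be x * be y)%g),
      (forall h k, commute (al h) (be k)), (forall a b, R a b -> al a = be b) &
      (p.-group [set: P])%g].

Section CentralProduct.
Variables (p : nat) (H K : grp) (R : H -> K -> Prop).
Hypotheses (pp : prime p) (RP : central_iso p R).
Hypotheses (fK : fin_generated K) (nK : nilpotent_grp K).

(* [P] is the central product of [X] with a finite p-quotient of [K] that induces on [B] exactly
   the quotient by the image of [A] meet [ker psi]. *)
Lemma central_pair_extend (X : finGroupType) (psi : H -> X) : pquot p psi ->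
  exists (P : finGroupType) (al : H -> P) (be : K -> P),
    central_pair p R al be /\
    forall h h', (exists z, al h' = (al h ^ z)%g) -> exists z, psi h' = (psi h ^ z)%g.
Proof.
move=> [psiM psi_onto pX]; have [n Xn] := pgroup_exponent pX.
pose C b := exists2 a, R a b & psi a = 1%g.
have [R1 RM RV Rf Ri Rcl Rcr isol isor] := RP.
have sC : is_subgroup C.
  split=> [|b b' [a Rab pa] [a' Rab' pa']|b [a Rab pa]].
  - by exists 1 => //; apply: fhom1.
  - by exists (a * a'); [apply: RM | rewrite psiM pa pa' mulg1].
  - by exists a^-1; [apply: RV | rewrite fhomV // pa invg1].
have RX a b m : R a b -> R (a ^+ m) (b ^+ m).
  by move=> Rab; elim: m => //= m; apply: RM.
have nC : gnormal C by apply: central_normal => b [a /Rcr].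
(* The partner [a'] of [y] has an image in [X] whose order divides both [q] and a power of [p]. *)
have iC : pprime_isolated p C.
  move=> q qP qp y [a Ray pa].
  have [|a' Ra'] := isor q qP qp y; first by exists a.
  exists a' => //; have e : a' ^+ q = a by apply: Ri Ray; apply: RX.
  apply/eqP; rewrite -order_eq1 -dvdn1.
  have : coprime q (p ^ n) by rewrite coprimeXr // prime_coprime // dvdn_prime2.
  rewrite /coprime => /eqP <-; rewrite dvdn_gcd !order_dvdn Xn eqxx andbT.
  by rewrite -fhomX // e pa.
(* For each value of [psi] on the amalgamated part, [k] picks one partner in [K]. Since [th] kills
   [C] and detects these finitely many elements modulo [C], a trivial [th b] will force a trivial
   [psi a]. *)
have [k kP] : exists k : X -> K, forall x a b, R a b -> psi a = x ->
    exists2 a', R a' (k x) & psi a' = x.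
  suff /choice[k kP] : forall x : X, exists y, forall a b, R a b -> psi a = x ->
    exists2 a', R a' y & psi a' = x by exists k.
  move=> x; have [[a [b [Rab ax]]]|no] := pselect (exists a b, R a b /\ psi a = x).
    by exists b => _ _ _ _; exists a.
  by exists 1 => a b Rab ax; case: no; exists a, b.
have [Y [th [thM pY thC thk]]] := isolated_p_separable_fin k pp fK nK sC nC iC.
have thR a b : R a b -> th b = 1%g -> psi a = 1%g.
  move=> Rab tb; have [a' Rk ak] := kP _ _ _ Rab erefl.
  have [|a'' Rk'' a''1] := thk (psi a).
    have /thC : C (b^-1 * k (psi a)).
      by exists (a^-1 * a'); [apply: RM => //; apply: RV | rewrite psiM fhomV // ak mulVg].
    by rewrite thM fhomV // tb invg1 mul1g.
  by rewrite -ak -(Ri _ _ _ Rk'' Rk).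
have [m Ym] := pgroup_exponent pY.
(* Dividing by [N] identifies [a] with [b] and forgets the kernels of [psi] and [th]: the quotient
   is the central product. *)
pose N (x : prodg H K) := exists a b, [/\ R a b, psi x.1 = psi a & th x.2 = th b^-1].
have sN : is_subgroup N.
  split=> [|x y [a [b [Rab xa xb]]] [a' [b' [Rab' ya yb]]]|x [a [b [Rab xa xb]]]].
  - by exists 1, 1; rewrite ginv1.
  - exists (a * a'), (b * b'); split; first exact: RM.
      by rewrite /= !psiM xa ya.
    by rewrite /= (Rcr _ _ Rab) ginvM !thM xb yb.
  - exists a^-1, b^-1; split; first exact: RV.
      by rewrite /= !fhomV // xa.
    by rewrite /= !fhomV // xb fhomV.
have nN : gnormal N.
  move=> x y [a [b [Rab xa xb]]]; exists a, b; split=> //=.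
    by rewrite !psiM xa -!psiM -gmulA (Rcl _ _ Rab) gmulKV.
  rewrite !thM xb -!thM -gmulA.
  by rewrite (Rcr _ _ (RV _ _ Rab)) gmulKV.
have [W [f [fM f_onto fN]]] := quotient_exists sN nN.
have Nker (x : prodg H K) : psi x.1 = 1%g -> th x.2 = 1%g -> N x.
  by move=> x1 x2; exists 1, 1; rewrite ginv1 x1 x2 !fhom1.
have [g gK] := choice f_onto.
have cI : injective (fun w => (psi (g w).1, th (g w).2)).
  move=> w v [e1 e2]; rewrite -(gK w) -(gK v); apply: geq_mulV; rewrite -homV // -fM.
  by apply/fN; apply: Nker; rewrite /= ?psiM ?thM fhomV // ?e1 ?e2 mulVg.
have [|P [om [[omM om_onto pP] omI]]] := finite_pquot pp cI.
  move=> w; exists (n + m)%N; rewrite -(gK w) -homX //; apply/fN; apply: Nker.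
    have -> : forall l, ((g w) ^+ l).1 = (g w).1 ^+ l by elim=> //= l ->.
    by rewrite fhomX // expnD expgM Xn expg1n.
  have -> : forall l, ((g w) ^+ l).2 = (g w).2 ^+ l by elim=> //= l ->.
  by rewrite fhomX // expnD mulnC expgM Ym expg1n.
pose al h := om (f ((h, 1) : prodg H K)); pose be k := om (f ((1, k) : prodg H K)).
exists P, al, be; split; first split=> //.
- by move=> x y; rewrite -omM -fM prodgM gmul1.
- by move=> x y; rewrite -omM -fM prodgM gmul1.
- by move=> x y; rewrite /commute -!omM -!fM; rewrite !prodgM !gmul1 !gmul1r.
- move=> a b Rab; suff e : f ((a, 1) : prodg H K) = f ((1, b) : prodg H K) by rewrite /al e.
  apply: geq_mulV; rewrite -(homV fM) -fM prodgV prodgM; apply/fN.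
  exists a^-1, b^-1; split; first exact: RV.
    by rewrite /= gmul1r.
  by rewrite /= ginv1 gmul1 ginvK.
(* A conjugacy in [P] leaves a discrepancy in [N] with trivial second component; [thR] then makes it
   invisible to [psi]. *)
move=> h h' [z]; have [w <-] := om_onto z; have [[x y] <-] := f_onto w.
rewrite /conjg /al -(fhomV omM) -!omM => /omI e.
have /fN[a [b [Rab /= xa xb]]] : f ((((x^-1 * h * x)^-1 * h'), 1) : prodg H K) = 1.
  apply: (@gmulI _ (f ((x^-1 * h * x, 1) : prodg H K))); rewrite -fM gmul1r.
  transitivity (f ((h', 1) : prodg H K)).
    by rewrite prodgM gmulVK gmul1.
  by rewrite e -(homV fM) -!fM prodgV !prodgM gmul1 gmulV gmulA.
exists (psi x); have pa : psi a = 1%g.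
  apply: (thR a b) => //; apply: invg_inj; rewrite -(fhomV thM) -xb fhom1 // invg1 //.
move: xa; rewrite pa psiM fhomV // => /eqP; rewrite -eq_mulVg1 => /eqP <-.
by rewrite !psiM fhomV // /conjg mulgA.
Qed.

Hypothesis csH : conj_p_separable p H.

(** A nontrivial element is not conjugate to 1, so conjugacy p-separability of [H] yields residual
    p-finiteness; a product of pairs handles the whole family [d]. *)
Lemma central_pair_separate (I : finType) (d : I -> H) :
  exists (P : finGroupType) (al : H -> P) (be : K -> P),
    central_pair p R al be /\ forall i, al (d i) = 1%g -> d i = 1.
Proof.
suff [P [al [be [cp dP]]]] : exists (P : finGroupType) (al : H -> P) (be : K -> P),
    central_pair p R al be /\ forall i, i \in enum I -> al (d i) = 1%g -> d i = 1.
  by exists P, al, be; split=> // i; apply: dP; rewrite mem_enum.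
elim: (enum I) => [|i s [P [al [be [cp dP]]]]].
  have [gT pgT] := trivial_pgroup p.
  by exists gT, (fun=> 1%g), (fun=> 1%g); split=> //; split=> // *; rewrite ?mulg1.
have [di|ndi] := pselect (d i = 1).
  by exists P, al, be; split=> // j; rewrite inE => /predU1P[-> //|]; apply: dP.
have [|X [psi [psiM psi_onto pX nc]]] := @csH (d i) 1.
  case=> g e; apply: ndi; apply: (@gmulI _ g^-1); rewrite gmul1r.
  by rewrite -{2}(gmul1 g^-1) e -!gmulA gmulVr gmul1r.
have [P' [al' [be' [cp' cP']]]] := central_pair_extend (And3 psiM psi_onto pX).
have [alM beM ab R_ab pP] := cp; have [alM' beM' ab' R_ab' pP'] := cp'.
exists (P * P')%type, (fun x => (al x, al' x)), (fun x => (be x, be' x)); split; first split.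
- by move=> x y; rewrite alM alM'.
- by move=> x y; rewrite beM beM'.
- by move=> x y; congr (_, _); [apply: ab | apply: ab'].
- by move=> a b Rab; rewrite (R_ab _ _ Rab) (R_ab' _ _ Rab).
- exact: pgroup_prod.
move=> j; rewrite inE => /predU1P[-> [_ h]|js [h _]]; last exact: dP.
case: nc; apply: (cP' (d i) 1); exists 1%g.
by rewrite h conj1g fhom1.
Qed.

End CentralProduct.

(** * Amalgams and separation of their elements *)

Record amalgam (H K : grp) (R : H -> K -> Prop) (G : grp) (iH : H -> G) (iK : K -> G) : Prop :=
  Amalgam {
  am_H : is_hom iH;
  am_K : is_hom iK;
  am_R : forall a b, R a b -> iH a = iK b;
  am_ext : forall (gT : finGroupType) (fH : H -> gT) (fK : K -> gT),
    (forall x y, fH (x * y) = (fH x * fH y)%g) -> (forall x y, fK (x * y) = (fK x * fK y)%g) ->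
    (forall a b, R a b -> fH a = fK b) ->
    exists f : G -> gT, [/\ (forall x y, f (x * y) = (f x * f y)%g),
      (forall h, f (iH h) = fH h) & (forall k, f (iK k) = fK k)];
  am_gen : forall P : G -> Prop, is_subgroup P -> (forall h, P (iH h)) -> (forall k, P (iK k)) ->
    forall x, P x }.

Lemma amalgam_sym (H K : grp) (R : H -> K -> Prop) (G : grp) (iH : H -> G) (iK : K -> G) :
  amalgam R iH iK -> amalgam (fun b a => R a b) iK iH.
Proof.
case=> hH hK hR ext gen; split=> //.
- by move=> a b Rab; rewrite (hR b a).
- move=> gT fH fK fHM fKM fR; have [|f [fM fH' fK']] := ext gT fK fH fKM fHM.
    by move=> a b Rab; rewrite (fR b a).
  by exists f.
- by move=> P sP PH PK; apply: gen.
Qed.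

(** Generation comes from uniqueness: [G] maps to the subgroup [P] and back to itself, and this
    composite agrees with the identity on both factors. *)
Lemma is_amalgam_amalgam (H K : grp) (A : H -> Prop) (phi : H -> K) (G : grp)
    (iH : H -> G) (iK : K -> G) :
  is_amalgam A phi iH iK -> amalgam (fun a b => A a /\ phi a = b) iH iK.
Proof.
case=> hH hK hA ext; split=> //.
- by move=> a _ [Aa <-]; apply: hA.
- move=> gT fH fK fHM fKM fR.
  have [|f [fM fH' fK' _]] := ext (fgrp gT) fH fK fHM fKM; last by exists f.
  by move=> a Aa; apply: fR.
- move=> P sP PH PK x.
  pose mu (u v : {x | P x}) : {x | P x} := exist _ (sval u * sval v) (subM sP (svalP u) (svalP v)).
  pose e : {x | P x} := exist _ 1 (sub1 sP).
  pose iv (u : {x | P x}) : {x | P x} := exist _ (sval u)^-1 (subV sP (svalP u)).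
  have muA u v w : mu u (mu v w) = mu (mu u v) w by apply: eq_exist; rewrite /= gmulA.
  have mu1 u : mu e u = u by case: u => y Py; apply: eq_exist; rewrite /= gmul1.
  have muV u : mu (iv u) u = e by apply: eq_exist; rewrite /= gmulV.
  pose L := Grp muA mu1 muV.
  have [|||f [fM fH fK _]] := ext L (fun h => exist _ (iH h) (PH h)) (fun k => exist _ (iK k) (PK k)).
  + by move=> y z; apply: eq_exist; rewrite /= hH.
  + by move=> y z; apply: eq_exist; rewrite /= hK.
  + by move=> a Aa; apply: eq_exist; rewrite /= hA.
  have [g [gM gH gK guniq]] := ext G iH iK hH hK hA.
  have -> : x = sval (f x).
    transitivity (g x); first exact: (guniq id).
    symmetry; apply: (guniq (fun y : G => sval (f y) : G)) => [y z|h|k]; first by rewrite fM.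
      by rewrite fH.
    by rewrite fK.
  exact: svalP.
Qed.

Definition separated p (G : grp) (a b : G) := exists (gT : finGroupType) (psi : G -> gT),
  pquot p psi /\ ~ (exists g : gT, psi b = (psi a ^ g)%g).

Lemma separated_image p (G : grp) (a b : G) (gT : finGroupType) (f : G -> gT) : prime p ->
  (forall x y, f (x * y) = (f x * f y)%g) -> (forall x, exists n, (f x ^+ (p ^ n) = 1)%g) ->
  (forall x, f b <> (f a ^ f x)%g) -> separated p a b.
Proof.
move=> pp fM fp nc; have [gT' [psi [qpsi psiE]]] := pquot_image pp fM fp.
have [psiM psi_onto _] := qpsi; exists gT', psi; split=> // -[z].
have [x <-] := psi_onto z; rewrite /conjg -fhomV // -!psiM => /psiE.
by rewrite !fM fhomV //; apply: nc.
Qed.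

Lemma separated_sym p (G : grp) (a b : G) : separated p a b -> separated p b a.
Proof.
move=> [gT [psi [qpsi nc]]]; exists gT, psi; split=> // -[g e]; apply: nc.
by exists g^-1%g; rewrite e conjgK.
Qed.

Section ConjIn.
Variable G : grp.
Implicit Types a b c : G.

Lemma conj_in_refl a : conj_in a a.
Proof. by exists 1; gnorm. Qed.
Lemma conj_in_sym a b : conj_in a b -> conj_in b a.
Proof. by move=> [g ->]; exists g^-1; gnorm. Qed.
Lemma conj_in_trans a b c : conj_in a b -> conj_in b c -> conj_in a c.
Proof. by move=> [g ->] [h ->]; exists (g * h); gnorm. Qed.
Lemma conj_in_comm a b : conj_in (a * b) (b * a).
Proof. by exists a; gnorm. Qed.
End ConjIn.

Lemma separated_conj p (G : grp) (a b a' b' : G) :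
  conj_in a a' -> conj_in b b' -> separated p a' b' -> separated p a b.
Proof.
move=> [g ->] [h ->] [gT [psi [qpsi nc]]]; have [psiM _ _] := qpsi.
exists gT, psi; split=> // -[z e]; apply: nc.
exists ((psi g)^-1 * z * psi h)%g.
have C u v : psi (v^-1 * u * v) = (psi u ^ psi v)%g by rewrite !psiM fhomV // /conjg mulgA.
by rewrite !C e -!conjgM !mulgA mulgV mul1g.
Qed.

(** * Separation of elements of the factors *)

Section Elliptic.
Variables (p : nat) (H K : grp) (R : H -> K -> Prop) (G : grp) (iH : H -> G) (iK : K -> G).
Hypotheses (pp : prime p) (RP : central_iso p R) (am : amalgam R iH iK).

Lemma elliptic_separated h h' : fin_generated K -> nilpotent_grp K -> conj_p_separable p H ->
  ~ conj_in (iH h) (iH h') -> separated p (iH h) (iH h').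
Proof.
move=> fK nK csH nc; have [hH hK hR ext gen] := am.
have [|X [psi [psiM psi_onto pX ncX]]] := @csH h h'.
  by case=> g e; apply: nc; exists (iH g); rewrite e !hH homV.
have [P [al [be [cp cP]]]] := central_pair_extend pp RP fK nK (And3 psiM psi_onto pX).
have [alM beM _ R_ab pP] := cp.
have [f [fM fH _]] := ext P al be alM beM R_ab.
have [n Pn] := pgroup_exponent pP.
apply: (separated_image pp fM); first by move=> x; exists n.
move=> x; rewrite !fH => e; apply: ncX; apply: cP; by exists (f x).
Qed.

(** Modulo the amalgamated subgroup, [h] survives in a finite p-quotient of [H], while all of [K]
    can be sent to the identity. *)
Lemma mixed_separated h k : fin_generated H -> nilpotent_grp H ->
  (forall b, ~ R h b) -> separated p (iH h) (iK k).
Proof.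
move=> fH nH nR; have [hH hK hR ext gen] := am.
have [R1 RM RV _ _ Rcl _ isol _] := RP.
have [||||X [psi [[psiM _ pX] psiR psih]]] := isolated_p_separable (C := fun a => exists b, R a b) (k := h) pp fH nH.
- split=> [|a a' [b Rab] [b' Rab']|a [b Rab]]; first by exists 1.
    by exists (b * b'); apply: RM.
  by exists b^-1; apply: RV.
- by apply: central_normal => a [b /Rcl].
- exact: isol.
- by case=> b /nR.
have [|||f [fM fiH fiK]] := ext X psi (fun=> 1%g) => //; first by move=> *; rewrite mulg1.
  by move=> a b Rab; apply: psiR; exists b.
have [n Xn] := pgroup_exponent pX.
apply: (separated_image pp fM); first by move=> x; exists n.
move=> x; rewrite fiH fiK => /esym/eqP; rewrite conjg_eq1 => /eqP; exact: psih.
Qed.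

End Elliptic.

Local Close Scope grp_scope.
Local Open Scope ring_scope.

(** * The winding representation *)

Section Congruence.
Variables (p : nat) (S : pzRingType).
Implicit Types X Y D : S.

Lemma congr_exp X Y D n : X = Y + D *+ p -> exists D', X ^+ n = Y ^+ n + D' *+ p.
Proof.
move=> XE; elim: n => [|n [D' IH]]; first by exists 0; rewrite !expr0 mul0rn addr0.
exists (Y * D' + D * Y ^+ n + (D * D') *+ p).
rewrite !exprS IH XE mulrDl !mulrDr !mulrnDl -!addrA; congr (_ + _).
by rewrite !mulrnAl !mulrnAr.
Qed.

(** [X ^+ p - 1] is [X - 1] times a sum of [p] powers of [X], each congruent to 1 modulo [p]; this
    sum supplies one more factor [p]. *)
Lemma congr1_expp X D k : (0 < k)%N -> X = 1 + D *+ (p ^ k)%N ->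
  exists D', X ^+ p = 1 + D' *+ (p ^ k.+1)%N.
Proof.
move=> k0 XE.
have /choice[F FE] : forall i : nat, exists D', X ^+ i = 1 + D' *+ p.
  move=> i; have [|D' DE] := @congr_exp X 1 (D *+ (p ^ k.-1)%N) i.
    by rewrite XE -mulrnA mulnC -expnS prednK.
  by exists D'; rewrite DE expr1n.
exists (D * (1 + \sum_(i < p) F i)).
apply/eqP; rewrite addrC -subr_eq subrX1 {1}XE [1 + _]addrC addrK.
under eq_bigr => i _ do rewrite FE.
rewrite big_split /= sumr_const card_ord sumrMnl -mulrnDl.
by rewrite mulrnAr mulrnAl -mulrnA expnSr.
Qed.

Lemma congr1_exppn X D n : X = 1 + D *+ p -> exists D', X ^+ (p ^ n)%N = 1 + D' *+ (p ^ n.+1)%N.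
Proof.
move=> XE; elim: n => [|n [D' IH]]; first by exists D; rewrite expn0 expr1 expn1.
by rewrite expnSr exprM; apply: congr1_expp IH.
Qed.

End Congruence.

Section WindingRep.
Variables (Q P : finGroupType) (N : nat) (c : 'I_N -> Q) (pi : 'I_N -> P).
Variables (m : nat) (er : 'I_N * Q * P -> 'I_m.+1) (ev : 'I_m.+1 -> 'I_N * Q * P).
Hypotheses (erK : cancel er ev) (evK : cancel ev er).

Local Notation I := ('I_N * Q * P)%type.
Local Notation letter := (bool * Q * P)%type.
Implicit Types (l : letter) (w : seq letter) (i : I) (j : 'I_N) (q g : Q) (y r : P) (b : bool).

Definition bvec i : 'rV[int]_m.+1 := delta_mx 0 (er i).

Lemma bvecE i i' : bvec i 0 (er i') = (i == i')%:R.
Proof. by rewrite mxE eqxx /= eq_sym (inj_eq (can_inj erK)). Qed.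

Lemma bvec_ext (A B : 'M[int]_m.+1) : (forall i, bvec i *m A = bvec i *m B) -> A = B.
Proof.
move=> h; apply/row_matrixP => a; rewrite !rowE; have := h (ev a).
by rewrite /bvec evK.
Qed.

(* In the state [(j, q, y)], [q] is the product of the letters read by position [j] since it was
   entered; only letters of the type of [j] (the parity of [j]) are read there.  [y] is multiplied by
   each letter, and by the inverse of [pi j] when [j] is left.  The difference [g - 1] entered at
   [j + 1] comes from the augmentation ideal of the group ring of [Q]; with it [rep_mx] is
   multiplicative, see [rep_mxM]. *)
Definition stay l i : I :=
  let: (b, g, r) := l in let: (j, q, y) := i in
  (j, if odd j == b then (q * g)%g else q, (y * r)%g).

Definition step l i : 'rV[int]_m.+1 :=
  let: (b, g, r) := l in let: (j, q, y) := i in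
  if (odd j != b) && (q == c j) then
    bvec (ordS j, g, (y * (pi j)^-1 * r)%g) - bvec (ordS j, 1%g, (y * (pi j)^-1 * r)%g)
  else 0.

Definition stay_mx l : 'M[int]_m.+1 := \matrix_a bvec (stay l (ev a)).
Definition step_mx l : 'M[int]_m.+1 := \matrix_a step l (ev a).
Definition rep_mx (t : int) l := stay_mx l + t *: step_mx l.

Lemma bvec_stay_mx i l : bvec i *m stay_mx l = bvec (stay l i).
Proof. by rewrite -rowE rowK erK. Qed.
Lemma bvec_step_mx i l : bvec i *m step_mx l = step l i.
Proof. by rewrite -rowE rowK erK. Qed.
Lemma bvec_rep_mx t i l : bvec i *m rep_mx t l = bvec (stay l i) + t *: step l i.
Proof. by rewrite mulmxDr -scalemxAr bvec_stay_mx bvec_step_mx. Qed.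

Lemma rep_mx1 t b : rep_mx t (b, 1%g, 1%g) = 1%:M.
Proof.
by apply: bvec_ext => -[[j q] y]; rewrite bvec_rep_mx mulmx1 /= !mulg1 subrr !if_same scaler0 addr0.
Qed.

(** With trivial [Q]-component the step vanishes and staying no longer depends on the side, so an
    amalgamated element acts alike from both factors. *)
Lemma rep_mx_core t b b' r : rep_mx t (b, 1%g, r) = rep_mx t (b', 1%g, r).
Proof.
apply: bvec_ext => -[[j q] y]; rewrite !bvec_rep_mx /= !mulg1 !subrr !if_same //.
Qed.

Hypothesis evenN : ~~ odd N.

Lemma odd_ordS j : odd (ordS j) = ~~ odd j.
Proof.
have := congr1 odd (divn_eq j.+1 N); rewrite oddD oddM (negbTE evenN) andbF /= => <-.
by [].
Qed.

(** At a position of the other type, staying then stepping gives g' - 1, stepping then staying gives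
    gg' - g', and the sum is gg' - 1. Parity excludes two steps, and [r] passes [pi j] by
    commutation. *)
Lemma rep_mxM t b g g' r r' : (forall j, odd j != b -> commute r (pi j)) ->
  rep_mx t (b, g, r) *m rep_mx t (b, g', r') = rep_mx t (b, (g * g')%g, (r * r')%g).
Proof.
move=> rpi; apply: bvec_ext => -[[j q] y]; rewrite mulmxA !bvec_rep_mx mulmxDl -scalemxAl.
rewrite bvec_rep_mx /=; have [ojb|ojb] := eqVneq (odd j) b.
  by rewrite /= mul0mx !scaler0 !addr0 !mulgA.
have e : (y * (pi j)^-1 * (r * r') = y * r * (pi j)^-1 * r')%g.
  by rewrite !mulgA -(mulgA y _ r) -(commuteV (rpi j ojb)) !mulgA.
rewrite /= e; case: (q == c j) => /=; last by rewrite mul0mx !scaler0 !addr0 mulgA.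
rewrite mulgA -addrA; congr (_ + _); rewrite -scalerDr; congr (_ *: _).
rewrite mulmxBl !bvec_rep_mx /= odd_ordS.
have -> : ~~ odd j == b by move: (odd j) (b) ojb => [] [].
rewrite /= !scaler0 !addr0 mul1g.
have -> : (y * r * (pi j)^-1 * r' = y * (pi j)^-1 * r * r')%g by rewrite -e !mulgA.
by rewrite addrC addrA subrK.
Qed.

Definition word_mx (S : pzRingType) (F : letter -> 'M[S]_m.+1) w := foldr (fun l A => F l *m A) 1%:M w.

Section ModP.
Variable p : nat.

(** Staying preserves the position, so a word multiplies [q] by an element depending only on [j] and
    [y] by a fixed one. *)
Lemma word_stay_pow w n : (#|Q| %| n)%N -> (#|P| %| n)%N -> (word_mx stay_mx w) ^+ n = 1.
Proof.
move=> Qn Pn.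
have [A [B AB]] : exists (A : 'I_N -> Q) B, forall j q y,
    bvec (j, q, y) *m word_mx stay_mx w = bvec (j, (q * A j)%g, (y * B)%g).
  elim: w => [|[[b g] r] w [A [B AB]]].
    by exists (fun=> 1%g), 1%g => j q y; rewrite mulmx1 !mulg1.
  exists (fun j => if odd j == b then (g * A j)%g else A j), (r * B)%g => j q y.
  by rewrite /= mulmxA bvec_stay_mx /= AB mulgA; case: ifP; rewrite ?mulgA.
have AB' k j q y : bvec (j, q, y) *m (word_mx stay_mx w) ^+ k = bvec (j, (q * A j ^+ k)%g, (y * B ^+ k)%g).
  elim: k j q y => [|k IH] j q y; first by rewrite mulmx1 !mulg1.
  by rewrite exprS -mulmxE mulmxA AB IH !expgS !mulgA.
apply: bvec_ext => -[[j q] y]; rewrite AB' mulmx1.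
have -> : (A j ^+ n = 1)%g by apply/eqP; rewrite -order_dvdn (dvdn_trans _ Qn) // -cardsT order_dvdG ?inE.
have -> : (B ^+ n = 1)%g by apply/eqP; rewrite -order_dvdn (dvdn_trans _ Pn) // -cardsT order_dvdG ?inE.
by rewrite !mulg1.
Qed.

Lemma word_rep_modp (t : int) w : exists D, word_mx (rep_mx (t * p%:R)) w = word_mx stay_mx w + D *+ p.
Proof.
elim: w => [|l w [D IH]]; first by exists 0; rewrite mul0rn addr0.
exists (stay_mx l *m D + (t *: step_mx l) *m word_mx (rep_mx (t * p%:R)) w).
rewrite /= {1}/rep_mx mulmxDl mulrnDl addrA; congr (_ + _).
  by rewrite IH mulmxDr; congr (_ + _); rewrite -!scaler_nat -scalemxAr.
by rewrite -scalerA -!scalemxAl scalerA mulrC -scalerA -!scaler_nat.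
Qed.

End ModP.

Section Polynomial.

Definition rep_polymx l : 'M[{poly int}]_m.+1 := map_mx polyC (stay_mx l) + 'X *: map_mx polyC (step_mx l).

Lemma word_rep_eval t w : map_mx (horner_eval t) (word_mx rep_polymx w) = word_mx (rep_mx t) w.
Proof.
elim: w => [|l w IH] /=; first by rewrite map_mx1.
rewrite map_mxM /= IH; congr (_ *m _); apply/matrixP => a b.
by rewrite !mxE /horner_eval !hornerE.
Qed.

(** Each letter has degree at most 1 in ['X], so the top coefficient arises only when every letter
    steps. *)
Lemma word_rep_coef w k : (size w <= k)%N ->
  map_mx (coefp k) (word_mx rep_polymx w) = if k == size w then word_mx step_mx w else 0.
Proof.
elim: w k => [|l w IH] [|k] //= wk.
- by apply/matrixP => a b; rewrite !mxE /= coefMn coef1 ?mulrb.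
- by apply/matrixP => a b; rewrite !mxE /= coefMn coef1 mul0rn.
apply/matrixP => a b; rewrite !mxE /= coef_sum.
have IH1 := IH k wk; have IH2 := IH k.+1 (leqW wk).
rewrite eqSS; transitivity (\sum_j (step_mx l a j * (map_mx (coefp k) (word_mx rep_polymx w)) j b)).
  apply: eq_bigr => j _; rewrite !mxE mulrDl coefD coefCM -mulrA coefXM /= coefCM.
  have := congr1 (fun A : 'M_m.+1 => A j b) IH2; rewrite gtn_eqF ?ltnS // !mxE /= => ->.
  by rewrite mulr0 add0r.
rewrite IH1; case: ifP => _; first by rewrite mxE.
by rewrite mxE; apply: big1 => j _; rewrite [X in _ * X]mxE mulr0.
Qed.

Lemma trace_word_rep_coef w k : (size w <= k)%N ->
  (\tr (word_mx rep_polymx w))`_k = if k == size w then \tr (word_mx step_mx w) else 0.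
Proof.
move=> /word_rep_coef e; have -> : (\tr (word_mx rep_polymx w))`_k = \tr (map_mx (coefp k) (word_mx rep_polymx w)).
  by rewrite /mxtrace coef_sum; apply: eq_bigr => a _; rewrite mxE.
by rewrite e; case: ifP => // _; rewrite mxtrace0.
Qed.

End Polynomial.

Hypothesis c1 : forall j, c j != 1%g.

Fixpoint walk j q w : bool :=
  match w with
  | [::] => true
  | (b, g, _) :: w' => [&& odd j != b, q == c j & walk (ordS j) g w']
  end.

(** Built to telescope: when the [P]-component of each letter is [pi] of the position it enters,
    only the two ends remain. *)
Fixpoint transport j w : P :=
  match w with
  | [::] => 1%g
  | (_, _, r) :: w' => ((pi j)^-1 * r * transport (ordS j) w')%g
  end.

(** Each step also subtracts the state with trivial [q], from which no further step is possible
    because [c] is never trivial; only the last subtraction survives. *)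
Lemma bvec_word_step l w j q y : let j' := iter (size w).+1 (@ordS N) j in
  let y' := (y * transport j (l :: w))%g in
  bvec (j, q, y) *m word_mx step_mx (l :: w) =
  if walk j q (l :: w) then bvec (j', (last l w).1.2, y') - bvec (j', 1%g, y') else 0.
Proof.
elim: w l j q y => [|l' w IH] l j q y.
  by case: l => [[b g] r]; rewrite /= mulmx1 bvec_step_mx /= andbT mulg1 mulgA.
move=> j' y'; have -> : word_mx step_mx (l :: l' :: w) = step_mx l *m word_mx step_mx (l' :: w) by [].
have sE : step l (j, q, y) = if (odd j != l.1.1) && (q == c j) then
    bvec (ordS j, l.1.2, (y * (pi j)^-1 * l.2)%g) - bvec (ordS j, 1%g, (y * (pi j)^-1 * l.2)%g)
    else 0 by case: l {j' y'} => [[]].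
have wE : walk j q (l :: l' :: w) =
    [&& odd j != l.1.1, q == c j & walk (ordS j) l.1.2 (l' :: w)] by case: l {j' y' sE} => [[]].
have yE : y' = (y * (pi j)^-1 * l.2 * transport (ordS j) (l' :: w))%g.
  rewrite /y'; have -> : transport j (l :: l' :: w) =
    ((pi j)^-1 * l.2 * transport (ordS j) (l' :: w))%g by case: l {j' y' sE wE} => [[]].
  by rewrite !mulgA.
have w1 : walk (ordS j) 1%g (l' :: w) = false.
  by case: l' {IH j' y' sE wE yE} => [[b g] r] /=; rewrite [1%g == _]eq_sym (negbTE (c1 _)) andbF.
rewrite mulmxA bvec_step_mx sE wE andbA; case: (_ && _); last by rewrite mul0mx.
by rewrite andTb mulmxBl !IH w1 subr0 -iterSr yE.
Qed.

Lemma iter_ordS k j : (iter k (@ordS N) j : nat) = ((j + k) %% N)%N.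
Proof.
elim: k => [|k IH]; first by rewrite addn0 modn_small.
by rewrite iterS /= IH addnS -addn1 modnDml addn1.
Qed.

Definition closed_walk j q w := [&& walk j q w, (last (false, 1%g, 1%g) w).1.2 == q & transport j w == 1%g].

(** A walk starts with [q = c j], which is nontrivial, so the subtracted vector misses the
    diagonal. *)
Lemma word_step_diag w j q y : size w = N ->
  word_mx step_mx w (er (j, q, y)) (er (j, q, y)) = (closed_walk j q w)%:R.
Proof.
case: w => [N0|l w sw]; first by have := leq_trans (ltn_ord j) (eq_leq (esym N0)).
have -> : word_mx step_mx (l :: w) (er (j, q, y)) (er (j, q, y)) =
    (bvec (j, q, y) *m word_mx step_mx (l :: w)) 0 (er (j, q, y)) by rewrite /bvec -rowE [RHS]mxE.
rewrite bvec_word_step /closed_walk; case: ifP => wk; last by rewrite mxE.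
have -> : iter (size w).+1 (@ordS N) j = j.
  by have sw' : (size w).+1 = N := sw; apply: ord_inj; rewrite iter_ordS sw' modnDr modn_small.
have qc : (1%g == q) = false.
  by case: l wk {sw} => [[b g] r] /= /and3P[_ /eqP -> _]; rewrite eq_sym (negbTE (c1 _)).
rewrite mxE [X in _ + X]mxE !bvecE !xpair_eqE eqxx qc /= subr0.
have e x : ((y * x)%g == y) = (x == 1%g) by rewrite -{2}(mulg1 y) (inj_eq (mulgI y)).
by rewrite e.
Qed.

Lemma trace_word_step w : size w = N ->
  \tr (word_mx step_mx w) = (\sum_(i : I) closed_walk i.1.1 i.1.2 w)%:R.
Proof.
move=> sw; rewrite /mxtrace (reindex er) /=; last by exists ev => i _; rewrite ?erK ?evK.
by rewrite natr_sum; apply: eq_bigr => -[[j q] y] _; rewrite word_step_diag.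
Qed.

End WindingRep.

Local Close Scope ring_scope.
Local Open Scope grp_scope.

(** * Separation by traces *)

Lemma Zp_intr_eq0 n (v : int) : (1 < n)%N -> (v%:~R = 0 :> 'Z_n)%R -> n %| `|v|%N.
Proof.
move=> n1 v0; have : ((`|v|%N)%:R = 0 :> 'Z_n)%R.
  case: v v0 => k //; rewrite NegzE mulrNz => /eqP; rewrite oppr_eq0 => /eqP e.
  by rewrite -[RHS]e.
move/(congr1 val); rewrite /= val_Zp_nat //= => /eqP e.
by rewrite /dvdn.
Qed.

(** A nonzero polynomial has fewer roots than its size, so it cannot vanish at that many distinct
    powers of [p]. *)
Lemma poly_int_pow_neq0 p (D : {poly int}) : prime p -> D != 0%R ->
  exists L, (D.[(p ^ L.+1)%:R] != 0)%R.
Proof.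
move=> pp D0; apply: contrapT => no.
pose rs : seq int := [seq (p ^ L.+1)%:R%R | L <- iota 0 (size D)].
have : (size rs < size D)%N.
  apply: max_poly_roots => //.
    apply/allP => _ /mapP[L _ ->]; rewrite rootE; apply: contrapT => h; apply: no; exists L.
    exact/negP.
  rewrite map_inj_uniq ?iota_uniq // => a b /eqP; rewrite eqr_nat eqn_exp2l ?prime_gt1 // eqSS => /eqP ->; exact: erefl.
by rewrite /rs size_map size_iota ltnn.
Qed.

Section Words.
Variables (H K : grp) (R : H -> K -> Prop) (G : grp) (iH : H -> G) (iK : K -> G).
Hypothesis am : amalgam R iH iK.
Local Notation letter := (H + K)%type.

Definition ev (l : letter) : G := match l with inl h => iH h | inr k => iK k end.
Definition evw (w : seq letter) : G := foldr (fun l x => ev l * x) 1 w.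
Definition side (l : letter) : bool := if l is inr _ then true else false.
Definition in_core (l : letter) : Prop :=
  match l with inl h => exists b, R h b | inr k => exists a, R a k end.

Lemma evw_cat u v : evw (u ++ v) = evw u * evw v.
Proof. by elim: u => [|l u IH] /=; rewrite ?gmul1 // IH gmulA. Qed.

Lemma evw_onto x : exists w, evw w = x.
Proof.
apply: (am_gen am (P := fun x => exists w, evw w = x)).
- have sV l : exists l', ev l' = (ev l)^-1.
    case: l => [h|k]; first by exists (inl h^-1); rewrite /= (homV (am_H am)).
    by exists (inr k^-1); rewrite /= (homV (am_K am)).
  split=> [|_ _ [u <-] [v <-]|_ [u <-]]; first by exists [::].
    by exists (u ++ v); apply: evw_cat.
  elim: u => [|l u [v IH]]; first by exists [::]; rewrite /= ginv1.
  have [l' le] := sV l; exists (v ++ [:: l']).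
  by rewrite evw_cat IH /= gmul1r le ginvM.
- by move=> h; exists [:: inl h]; rewrite /= gmul1r.
- by move=> k; exists [:: inr k]; rewrite /= gmul1r.
Qed.

Lemma evw_rot n w : conj_in (evw w) (evw (seq.rot n w)).
Proof. by rewrite /seq.rot evw_cat -{1}(cat_take_drop n w) evw_cat; apply: conj_in_comm. Qed.

Section TraceSeparation.
Variables (p : nat) (Q P : finGroupType) (gH : H -> Q) (gK : K -> Q) (al : H -> P) (be : K -> P).
Hypotheses (pp : prime p) (cp : central_pair p R al be) (pQ : (p.-group [set: Q])%g).
Hypotheses (gHM : forall x y, gH (x * y) = (gH x * gH y)%g)
           (gKM : forall x y, gK (x * y) = (gK x * gK y)%g).
Hypotheses (gR : forall a b, R a b -> gH a = 1%g /\ gK b = 1%g).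
Variables (N : nat) (c : 'I_N -> Q) (pi : 'I_N -> P).
Hypotheses (evenN : ~~ odd N)
  (al_pi : forall h (j : 'I_N), odd j -> commute (al h) (pi j))
  (be_pi : forall k (j : 'I_N), ~~ odd j -> commute (be k) (pi j)).

Definition code (l : letter) : bool * Q * P :=
  match l with inl h => (false, gH h, al h) | inr k => (true, gK k, be k) end.

Variables (m : nat) (er : 'I_N * Q * P -> 'I_m.+1) (ev' : 'I_m.+1 -> 'I_N * Q * P).
Hypotheses (erK : cancel er ev') (evK : cancel ev' er).

Local Notation trX w := (\tr (word_mx (rep_polymx c pi er ev') (map code w)))%R.

(** Letters act by invertible matrices over ['Z_(p ^ e)], which defines a homomorphism on [G].
    Conjugate images would have equal traces. *)
Lemma trace_separated wa wb : trX wa <> trX wb -> separated p (evw wa) (evw wb).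
Proof.
have [alM beM _ albe pP] := cp.
move=> /eqP; rewrite -subr_eq0 => D0; set D := (_ - _)%R in D0.
have [L v0] := poly_int_pow_neq0 pp D0.
set t : int := (p ^ L)%:R%R; have tE : ((p ^ L.+1)%:R = t * p%:R :> int)%R by rewrite -natrM expnSr.
rewrite tE in v0; set v := D.[_]%R in v0.
(* Since [p ^ e] exceeds [e], the absolute value of [v], the difference [v] of the traces is nonzero
   modulo [p ^ e]. *)
pose e := `|v|%N; have e0 : (0 < e)%N by rewrite absz_gt0.
have pe1 : (1 < p ^ e)%N by rewrite -(expn0 p) ltn_exp2l ?prime_gt1.
pose S := 'M['Z_(p ^ e)]_m.+1.
pose F (X : 'M[int]_m.+1) : S := map_mx intr X.
have FM X Y : F (X *m Y)%R = (F X * F Y)%R by rewrite /F map_mxM.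
have F1 : F 1%:M%R = 1%R by rewrite /F map_mx1.
pose T l := F (rep_mx c pi er ev' (t * p%:R)%R (code l)).
have Tinv l : exists l', (T l' * T l = 1 /\ T l * T l' = 1)%R.
  case: l => [h|k].
    have hc h' (j : 'I_N) : odd j != false -> commute (al h') (pi j) by rewrite eqbF_neg negbK; apply: al_pi.
    exists (inl h^-1); rewrite /T -!FM /= !(rep_mxM _ erK evK evenN); try exact: hc.
    by rewrite -!gHM -!alM gmulV gmulVr !fhom1 // (rep_mx1 c pi erK evK).
  have kc k' (j : 'I_N) : odd j != true -> commute (be k') (pi j) by rewrite eqb_id; apply: be_pi.
  exists (inr k^-1); rewrite /T -!FM /= !(rep_mxM _ erK evK evenN); try exact: kc.
  by rewrite -!gKM -!beM gmulV gmulVr !fhom1 // (rep_mx1 c pi erK evK).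
have Tu l : T l \is a GRing.unit by apply/unitrP; have [l' h] := Tinv l; exists (T l').
pose U l : {unit S} := FinRing.unit S (Tu l).
have [|||f [fM fH fK]] := @am_ext _ _ _ _ _ _ am _ (fun h => U (inl h)) (fun k => U (inr k)).
- move=> x y; apply: val_inj; rewrite /= -FM (rep_mxM _ erK evK evenN).
    by rewrite /T /= gHM alM.
  by move=> j; rewrite eqbF_neg negbK; apply: al_pi.
- move=> x y; apply: val_inj; rewrite /= -FM (rep_mxM _ erK evK evenN).
    by rewrite /T /= gKM beM.
  by move=> j; rewrite eqb_id; apply: be_pi.
- move=> a b Rab; apply: val_inj; rewrite /= /T /=.
  by have [-> ->] := gR Rab; rewrite (albe _ _ Rab) (rep_mx_core c pi erK evK _ false true).
have fw w : val (f (evw w)) = F (word_mx (rep_mx c pi er ev' (t * p%:R)%R) (map code w)).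
  elim: w => [|l w IH] /=; first by rewrite (fhom1 fM) F1.
  rewrite fM FM -IH; congr (_ * _)%R.
  by case: l => [h|k] /=; rewrite ?fH ?fK.
have [n nE] : exists n, (#|{: Q * P}| = p ^ n)%N.
  have [_ _ _ _ pP'] := cp; have := pgroup_prod pQ pP'.
  by rewrite /pgroup cardsT => /p_natP[n ->]; exists n.
apply: (separated_image pp fM).
  (* The power [p ^ n] makes the matrix congruent to 1 modulo [p]; [e] further p-th powers make it
     congruent to 1 modulo [p ^ e.+1]. *)
  move=> x; have [w <-] := evw_onto x; exists (n + e)%N; apply: val_inj.
  rewrite FinRing.val_unitX FinRing.val_unit1 fw expnD exprM.
  have [D1 ->] := word_rep_modp c pi er ev' p t (map code w).
  have [D2] := congr_exp (p ^ n) (erefl (word_mx (stay_mx er ev') [seq code i | i <- w] + D1 *+ p)%R).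
  rewrite (word_stay_pow erK evK); last first.
  - by rewrite -nE card_prod dvdn_mull.
  - by rewrite -nE card_prod dvdn_mulr.
  move=> /(congr1_exppn e)[D3 h3].
  have -> X k : (F X ^+ k)%R = F (X ^+ k)%R by rewrite /F rmorphXn.
  rewrite -!rmorphXn /= h3 rmorphD rmorph1 rmorphMn /=.
  suff -> : (F D3 *+ (p ^ e.+1) = 0)%R by rewrite addr0.
  apply/matrixP => i j; rewrite mulmxnE [RHS]mxE -mulr_natr expnSr natrM.
  by rewrite pchar_Zp // mul0r mulr0.
move=> x /(congr1 val) fab.
have : (\tr (val (f (evw wb))) = \tr (val (f (evw wa))))%R.
  rewrite fab /conjg !FinRing.val_unitM FinRing.val_unitV -!mulmxE mxtrace_mulC mulmxE.
  by rewrite -mulrA divrr ?mulr1 //; apply: (valP (f x)).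
rewrite !fw !trace_map_mx -!word_rep_eval !trace_map_mx => /eqP.
rewrite eq_sym -subr_eq0 -rmorphB /= => /eqP/(Zp_intr_eq0 pe1).
rewrite /horner_eval -hornerN -hornerD -/D -/v -/e => /dvdn_leq => /(_ e0).
by rewrite leqNgt ltn_expl ?prime_gt1.
Qed.

End TraceSeparation.

End Words.

(** * Cyclically reduced words *)

Section NormalForm.
Variables (H K : grp) (R : H -> K -> Prop) (G : grp) (iH : H -> G) (iK : K -> G).
Hypothesis am : amalgam R iH iK.
Local Notation letter := (H + K)%type.
Local Notation ev := (ev iH iK).
Local Notation evw := (evw iH iK).
Local Notation side := (@side H K).
Local Notation core := (in_core R).
Local Notation l0 := (inl 1 : letter).

(** The first letter comes from [H], so that sides agree with the parity of positions used by the
    winding action. *)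
Definition cyc_reduced (w : seq letter) := [/\ ~~ odd (size w), 0 < size w &
  forall k, k < size w -> side (nth l0 w k) = odd k /\ ~ core (nth l0 w k)].

Lemma ev_merge l l' : side l = side l' -> exists l'', ev l'' = ev l * ev l'.
Proof.
case: l l' => [h|k] [h'|k'] //= _; first by exists (inl (h * h')); rewrite /= (am_H am).
by exists (inr (k * k')); rewrite /= (am_K am).
Qed.

Lemma ev_flip l : core l -> exists l', side l' = ~~ side l /\ ev l' = ev l.
Proof.
case: l => [h|k] /= [x Rx]; first by exists (inr x); rewrite /= (am_R am Rx).
by exists (inl x); rewrite /= (am_R am Rx).
Qed.

Section Minimal.
Variables (g : G) (n : nat).
Hypothesis nmin : forall w, conj_in g (evw w) -> n <= size w.

(** Neighbours from the same factor merge into one letter, and a letter of the amalgamated subgroup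
    can first change sides; both would shorten the word. *)
Lemma minimal_head l l' u : conj_in g (evw (l :: l' :: u)) -> size (l :: l' :: u) = n ->
  side l' = ~~ side l /\ ~ core l.
Proof.
move=> cw sw.
have same l1 l2 : side l1 = side l2 -> conj_in g (evw (l1 :: l2 :: u)) -> False.
  move=> /ev_merge[l3 e3] c3; have : n <= size (l3 :: u) by apply: nmin; rewrite /= e3 -gmulA.
  by rewrite -sw /= ltnn.
have d : side l' = ~~ side l.
  case E : (side l == side l'); first by case: (same l l') => //; apply/eqP.
  by move: E; case: (side l); case: (side l').
split=> // /ev_flip[l2 [s2 e2]]; apply: (same l2 l'); first by rewrite s2 d.
by rewrite /= e2.
Qed.

Lemma minimal_alternating w : conj_in g (evw w) -> size w = n -> 1 < n ->
  (forall k, k < n -> side (nth l0 w k) = side (nth l0 w 0) (+) odd k /\ ~ core (nth l0 w k)) /\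
  ~~ odd n.
Proof.
move=> cw sw n1.
have rotP k : k < n -> side (nth l0 w (k.+1 %% n)) = ~~ side (nth l0 w k) /\ ~ core (nth l0 w k).
  move=> kn; have cr : conj_in g (evw (seq.rot k w)) := conj_in_trans cw (evw_rot _ _ k w).
  have sr : size (seq.rot k w) = n by rewrite size_rot.
  have e0 : nth l0 (seq.rot k w) 0 = nth l0 w k.
    by rewrite /seq.rot nth_cat size_drop subn_gt0 sw kn nth_drop addn0.
  have e1 : nth l0 (seq.rot k w) 1 = nth l0 w (k.+1 %% n).
    rewrite /seq.rot nth_cat size_drop nth_drop sw addn1.
    case: (ltnP k.+1 n) => kn1; first by rewrite ltn_subRL addn1 kn1 modn_small.
    have en : k.+1 = n by apply/eqP; rewrite eqn_leq kn.
    rewrite ltn_subRL addn1 en ltnn modnn nth_take; last by rewrite -(ltn_add2r 1) !addn1 en; lia.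
    by congr nth; lia.
  move: cr sr e0 e1; case: (seq.rot k w) => [|l [|l' u]] cr sr.
  - by move: n1; rewrite -sr.
  - by move: n1; rewrite -sr.
  - by move=> /= <- <-; apply: (minimal_head cr sr).
have alt k : k < n -> side (nth l0 w k) = side (nth l0 w 0) (+) odd k.
  elim: k => [|k IH] kn; first by rewrite addbF.
  have [] := rotP k (ltnW kn); rewrite modn_small // => -> _.
  by rewrite IH ?(ltnW kn) //= addbN.
split; first by move=> k kn; split; [apply: alt | case: (rotP k kn)].
have n0 : n.-1.+1 = n by apply: prednK; apply: ltnW.
have nn : n.-1 < n by rewrite n0.
(* Alternation across the end of the word, from the last letter to the first, forces even length. *)
have [] := rotP n.-1 nn; rewrite n0 modnn (alt _ nn) => e _.
rewrite -n0 /= negbK; move: e; case: (odd n.-1) => //; rewrite addbF.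
by case: (side _).
Qed.

End Minimal.

Lemma conj_normal_form g : exists w, conj_in g (evw w) /\ (size w <= 1 \/ cyc_reduced w).
Proof.
pose P n := `[< exists w, size w = n /\ conj_in g (evw w) >].
have exP : exists n, P n.
  have [w we] := evw_onto am g; exists (size w); apply/asboolP; exists w; split=> //.
  by rewrite we; apply: conj_in_refl.
case: (ex_minnP exP) => n /asboolP[w [sw cw]] nmin.
have nm u : conj_in g (evw u) -> n <= size u.
  by move=> cu; apply: nmin; apply/asboolP; exists u.
case: (leqP n 1) => n1; first by exists w; split=> //; left; rewrite sw.
have [alt en] := minimal_alternating nm cw sw n1.
case E : (side (nth l0 w 0)); last first.
  exists w; split=> //; right; rewrite /cyc_reduced sw; split=> //; first exact: ltnW.
  by move=> k kn; have [-> nc] := alt k kn; rewrite E.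
(* A word starting in [K] is rotated by one letter to start in [H]. *)
have cr : conj_in g (evw (seq.rot 1 w)) := conj_in_trans cw (evw_rot _ _ 1 w).
have sr : size (seq.rot 1 w) = n by rewrite size_rot.
have [altr _] := minimal_alternating nm cr sr n1.
have E1 : side (nth l0 (seq.rot 1 w) 0) = false.
  have -> : nth l0 (seq.rot 1 w) 0 = nth l0 w 1.
    by rewrite /seq.rot nth_cat size_drop subn_gt0 sw n1 nth_drop.
  by have [-> _] := alt 1%N n1; rewrite E.
exists (seq.rot 1 w); split=> //; right; rewrite /cyc_reduced sr; split=> //; first exact: ltnW.
by move=> k kn; have [-> nc] := altr k kn; rewrite E1.
Qed.

End NormalForm.

(** * Separation of cyclically reduced words *)

Section Hyperbolic.
Variables (p : nat) (H K : grp) (R : H -> K -> Prop) (G : grp) (iH : H -> G) (iK : K -> G).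
Hypotheses (pp : prime p) (RP : central_iso p R) (am : amalgam R iH iK).
Hypotheses (fH : fin_generated H) (nH : nilpotent_grp H) (fK : fin_generated K) (nK : nilpotent_grp K).
Hypothesis csH : conj_p_separable p H.
Local Notation letter := (H + K)%type.
Local Notation ev := (ev iH iK).
Local Notation evw := (evw iH iK).
Local Notation side := (@side H K).
Local Notation core := (in_core R).
Local Notation l0 := (inl 1 : letter).

Lemma core_central d b : R d b -> gcenter (iH d).
Proof.
move=> Rdb x; apply: (am_gen am (P := fun x => iH d * x = x * iH d)).
- split=> [|y z ey ez|y ey]; first by gnorm.
    by rewrite gmulA ey -gmulA ez gmulA.
  by apply/esym/gcommuteV/esym.
- by move=> h; rewrite -!(am_H am) (ci_centl RP Rdb).
- by move=> k; rewrite (am_R am Rdb) -!(am_K am) (ci_centr RP Rdb).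
Qed.

Lemma separate_letters N (x y : 'I_N -> letter) :
  exists (Q : finGroupType) (gH : H -> Q) (gK : K -> Q),
    [/\ (forall u v, gH (u * v) = (gH u * gH v)%g) /\ (forall u v, gK (u * v) = (gK u * gK v)%g),
        (p.-group [set: Q])%g,
        (forall a b, R a b -> gH a = 1%g /\ gK b = 1%g),
        (forall i, match x i with inl h => gH h = 1%g | inr k => gK k = 1%g end -> core (x i)) &
        (forall i j, match x i, y j with
           | inl h, inl h' => gH h = gH h' -> exists b, R (h^-1 * h') b
           | inr k, inr k' => gK k = gK k' -> exists a, R a (k^-1 * k')
           | _, _ => True end)].
Proof.
have [R1 RM RV Rf Ri Rcl Rcr isol isor] := RP.
pose hp (l : letter) := if l is inl h then h else 1.
pose kp (l : letter) := if l is inr k then k else 1.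
(* The index [None] tests the letter [x i] itself, and [Some j] compares it with [y j]; letters of
   the other factor are replaced by 1. *)
pose I : finType := ('I_N * option 'I_N)%type.
have [||Q1 [g1 [g1M pQ1 g1R g1P]]] := isolated_p_separable_fin (C := fun a => exists b, R a b)
   (fun i : I => if i.2 is Some j then (hp (x i.1))^-1 * hp (y j) else hp (x i.1)) pp fH nH _ _ isol.
- split=> [|a a' [b Rab] [b' Rab']|a [b Rab]]; first by exists 1.
    by exists (b * b'); apply: RM.
  by exists b^-1; apply: RV.
- by apply: central_normal => a [b /Rcl].
have [||Q2 [g2 [g2M pQ2 g2R g2P]]] := isolated_p_separable_fin (C := fun b => exists a, R a b)
   (fun i : I => if i.2 is Some j then (kp (x i.1))^-1 * kp (y j) else kp (x i.1)) pp fK nK _ _ isor.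
- split=> [|b b' [a Rab] [a' Rab']|b [a Rab]]; first by exists 1.
    by exists (a * a'); apply: RM.
  by exists a^-1; apply: RV.
- by apply: central_normal => b [a /Rcr].
exists (Q1 * Q2)%type, (fun h => (g1 h, 1%g)), (fun k => (1%g, g2 k)); split.
- by split=> u v; rewrite ?g1M ?g2M; congr (_, _); rewrite mulg1.
- exact: pgroup_prod.
- by move=> a b Rab; rewrite g1R ?g2R //; [exists a | exists b].
- move=> i; have := g1P (i, None); have := g2P (i, None) => /=.
  by case: (x i) => [h|k] /= h2 h1 [e]; [apply: h1 | apply: h2].
- move=> i j; have := g1P (i, Some j); have := g2P (i, Some j) => /=.
  case: (x i) (y j) => [h|k] [h'|k'] //= h2 h1 [e].
    by apply: h1; rewrite g1M (fhomV g1M) e mulVg.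
  by apply: h2; rewrite g2M (fhomV g2M) e mulVg.
Qed.

Section Cycle.
Variables (N : nat) (x : 'I_N -> letter).

(** The path starts after [j] because a state at [j] has just read [x j]; so the path from the last
    position spells the word from its first letter. *)
Fixpoint cpath (j : 'I_N) n : seq letter :=
  if n is n'.+1 then x (ordS j) :: cpath (ordS j) n' else [::].

Lemma cpath_rcons j n : cpath j n.+1 = rcons (cpath j n) (x (iter n.+1 (@ordS N) j)).
Proof.
elim: n j => [//|n IH] j.
by rewrite [in LHS]/= -[x (ordS (ordS j)) :: _]/(cpath (ordS j) n.+1) IH /= -iterSr.
Qed.

Lemma iter_ordS_N j : iter N (@ordS N) j = j.
Proof. by apply: ord_inj; rewrite iter_ordS modnDr modn_small. Qed.

Lemma cpath_conj j k : conj_in (evw (cpath j N)) (evw (cpath (iter k (@ordS N) j) N)).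
Proof.
elim: k => [|k IH]; first exact: conj_in_refl.
apply: conj_in_trans IH _; rewrite iterS; move: (iter k _ j) => {}j.
suff S M : iter M (@ordS N) (ordS j) = ordS j ->
    conj_in (evw (cpath j M)) (evw (cpath (ordS j) M)) by apply/S/iter_ordS_N.
case: M => [|n] eN; first by apply: conj_in_refl.
rewrite [cpath (ordS j) _]cpath_rcons eN [cpath j _]/=.
by rewrite -cats1 evw_cat /= gmul1r; apply: conj_in_comm.
Qed.

Lemma size_cpath j n : size (cpath j n) = n.
Proof. by elim: n j => //= n IH j; rewrite IH. Qed.

Lemma nth_cpath j n i : i < n -> nth l0 (cpath j n) i = x (iter i.+1 (@ordS N) j).
Proof. by elim: n j i => // n IH j [|i] //= ni; rewrite IH //= -iterSr. Qed.

End Cycle.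

Lemma last_cpath N (x : 'I_N -> letter) (T : Type) (F : letter -> T) z j n : 0 < n ->
  last z (map F (cpath x j n)) = F (x (iter n (@ordS N) j)).
Proof. by case: n => // n _; rewrite cpath_rcons map_rcons last_rcons. Qed.

Section Walks.
Variables (Q P : finGroupType) (gH : H -> Q) (gK : K -> Q) (al : H -> P) (be : K -> P).
Hypothesis cp : central_pair p R al be.
Variables (N : nat) (x : 'I_N -> letter).
Hypotheses (evenN : ~~ odd N) (sx : forall i, side (x i) = odd i).
Local Notation code := (code gH gK al be).
Local Notation c := (fun j => (code (x j)).1.2).
Local Notation pi := (fun j => (code (x j)).2).

Lemma walk_cons j q l w : walk c j q (code l :: w) =
  [&& odd j != side l, q == c j & walk c (ordS j) (code l).1.2 w].
Proof. by case: l. Qed.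

Lemma transport_cons j l w : transport pi j (code l :: w) =
  ((pi j)^-1 * (code l).2 * transport pi (ordS j) w)%g.
Proof. by case: l. Qed.

Lemma walk_cpath j n : walk c j (c j) (map code (cpath x j n)).
Proof.
elim: n j => [//|n IH] j.
rewrite [map _ _]/= walk_cons eqxx IH sx odd_ordS //.
by case: (odd j).
Qed.

Lemma transport_cpath j n : transport pi j (map code (cpath x j n)) =
  ((pi j)^-1 * pi (iter n (@ordS N) j))%g.
Proof.
elim: n j => [|n IH] j; first by rewrite /= mulVg.
by rewrite [map _ _]/= transport_cons IH -iterSr !mulgA mulgK.
Qed.

Lemma al_core_commute d b l : R d b -> commute (al d) (code l).2.
Proof.
have [alM beM ab _ _] := cp.
case: l => [h|k] Rdb /=; last exact: ab.
by rewrite /commute -!alM (ci_centl RP Rdb).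
Qed.

Variable good : letter -> Prop.
Hypothesis goodP : forall l i, good l -> side l = side (x i) -> (code l).1.2 = c i ->
  exists d b, [/\ R d b, ev l = ev (x i) * iH d & (code l).2 = ((code (x i)).2 * al d)%g].

Lemma walk_match u l j q : (forall i, i < size (l :: u) -> good (nth l0 (l :: u) i)) ->
  let n := size (l :: u) in
  walk c j q (map code (l :: u)) -> (code (last l u)).1.2 = c (iter n (@ordS N) j) ->
  exists d b, [/\ R d b, evw (l :: u) = evw (cpath x j n) * iH d &
    transport pi j (map code (l :: u)) = ((pi j)^-1 * pi (iter n (@ordS N) j) * al d)%g].
Proof.
have [alM _ _ _ _] := cp.
elim: u l j q => [|l' u IH] l j q gd n.
  rewrite [map _ _]/= walk_cons => /and3P[sl _ _] el.
  have [||d [b [Rdb e1 e2]]] := goodP (i := ordS j) (gd 0 isT) => //.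
    by rewrite sx odd_ordS //=; move: sl; case: (odd j); case: (side l).
  exists d, b; split=> //; first by rewrite /= e1 !gmul1r.
  by rewrite transport_cons [transport _ _ [::]]/= mulg1 e2 mulgA.
rewrite [map _ _]/= walk_cons => /and3P[sl _ wl] el.
have [||d' [b' [Rdb' e1' e2']]] := IH l' (ordS j) (code l).1.2 _ wl => //.
- by move=> i il; apply: (gd i.+1).
- by rewrite -iterSr.
have el1 : (code l).1.2 = c (ordS j).
  by move: wl; rewrite walk_cons => /and3P[_ /eqP].
have [||d [b [Rdb e1 e2]]] := goodP (i := ordS j) (gd 0 isT) => //.
  by rewrite sx odd_ordS //=; move: sl; case: (odd j); case: (side l).
exists (d * d'), (b * b'); split; first exact: (ciM RP).
  rewrite /n -[evw (l :: _)]/(ev l * evw (l' :: u)) e1' e1 [cpath x j _]/=.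
  rewrite -[evw (x _ :: _)]/(ev (x (ordS j)) * evw (cpath x (ordS j) (size (l' :: u)))).
  rewrite (am_H am); move: (evw (cpath x (ordS j) _)) => v.
  by rewrite !gmulA -(gmulA (ev _)) (core_central Rdb) !gmulA.
rewrite transport_cons e2' e2 alM -iterSr -/n.
have c1 := al_core_commute (x (ordS j)) Rdb.
have c2 := al_core_commute (x (iter n (@ordS N) j)) Rdb.
rewrite !mulgA; congr (_ * _)%g.
rewrite -!mulgA; congr (_ * _)%g.
by rewrite (mulgA (al d)) (commuteV c1) !mulgA mulgV mul1g c2.
Qed.

End Walks.

Lemma hyperbolic_separated wa wb : cyc_reduced R wa -> size wb <= size wa ->
  ~ conj_in (evw wa) (evw wb) -> separated p (evw wa) (evw wb).
Proof.
move=> [evenN N0 redP] swb nc; set N := size wa in evenN N0 redP swb.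
pose x (i : 'I_N) := nth l0 wa i.
pose y (i : 'I_N) := nth l0 wb i.
have sx i : side (x i) = odd i by have [] := redP i (ltn_ord i).
have jm_lt : N.-1 < N by rewrite prednK.
pose jm := Ordinal jm_lt.
have cyc_wa : cpath x jm N = wa.
  apply: (@eq_from_nth _ l0); first by rewrite size_cpath.
  rewrite size_cpath => i iN; rewrite nth_cpath // /x iter_ordS /= addnS -addSn prednK //.
  by rewrite modnDl modn_small.
have conj_cyc j : conj_in (evw wa) (evw (cpath x j N)).
  rewrite -{1}cyc_wa; have := cpath_conj x jm j.+1.
  have -> // : iter j.+1 (@ordS N) jm = j.
  by apply: ord_inj; rewrite iter_ordS /= addnS -addSn prednK // modnDl modn_small.
have [Q [gH [gK [[gHM gKM] pQ gR xP xyP]]]] := separate_letters x y.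
(* The possible discrepancies are fixed before [P], one for each starting position, since [P] has to
   detect them; positions without any receive 1. *)
have /choice[D DP] : forall j : 'I_N, exists d, forall d', (exists b, R d' b) ->
    evw wb = evw (cpath x j N) * iH d' -> (exists b, R d b) /\ evw wb = evw (cpath x j N) * iH d.
  move=> j; have [[d dP]|no] := pselect (exists d, (exists b, R d b) /\
     evw wb = evw (cpath x j N) * iH d); first by exists d.
  by exists 1 => d' Rd' e; case: no; exists d'.
have [P [al [be [cp alD]]]] := central_pair_separate pp RP fK nK csH D.
have [alM beM ab albe pP] := cp.
have [f [fM fiH fiK]] := am_ext am alM beM albe.
pose c (j : 'I_N) := (code gH gK al be (x j)).1.2.
pose pi (j : 'I_N) := (code gH gK al be (x j)).2.
have c1 j : c j != 1%g.
  apply/eqP => cj; have [_ []] := redP j (ltn_ord j); apply: xP.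
  by move: cj; rewrite /c; case: (x j).
have al_pi h (j : 'I_N) : odd j -> commute (al h) (pi j).
  by rewrite -sx /pi; case: (x j) => //= k _; apply: ab.
have be_pi k (j : 'I_N) : ~~ odd j -> commute (be k) (pi j).
  by rewrite -sx /pi; case: (x j) => //= h _; apply/commute_sym/ab.
pose I := ('I_N * Q * P)%type.
have eI : #|{: I}| = #|{: I}|.-1.+1.
  by rewrite prednK //; apply/card_gt0P; exists (jm, 1%g, 1%g).
pose er (i : I) := cast_ord eI (enum_rank i).
pose ev' a : I := enum_val (cast_ord (esym eI) a).
have erK : cancel er ev' by move=> i; rewrite /ev' /er cast_ordK enum_rankK.
have evK : cancel ev' er by move=> a; rewrite /ev' /er enum_valK cast_ordKV.
apply: (trace_separated am pp cp pQ gHM gKM gR evenN al_pi be_pi erK evK (c := c)).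
move/(congr1 (fun q : {poly int} => nth 0%R q N)).
rewrite !trace_word_rep_coef ?size_map // eqxx (trace_word_step pi erK evK c1) ?size_map //.
set Sa := (\sum_i _)%N; have Sa0 : 0 < Sa.
  rewrite /Sa (bigD1 (jm, c jm, 1%g)) //= addn_gt0 lt0b; apply/orP; left.
  rewrite -cyc_wa /closed_walk walk_cpath // transport_cpath // iter_ordS_N mulVg eqxx andbT.
  by rewrite last_cpath // iter_ordS_N; exact: eqxx.
move=> e; have : (Sa%:R != 0 :> int)%R by rewrite pnatr_eq0 -lt0n.
rewrite e; case E : (N == size wb); last by rewrite eqxx.
have sw := eqP E.
rewrite (trace_word_step pi erK evK c1) ?size_map // big1 // => -[[j q] z] _ /=.
apply/eqP; rewrite eqb0; apply/negP; case/and3P => wk lst tr.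
case Ew : wb => [|l u]; first by move: N0; rewrite sw Ew.
rewrite Ew in wk lst tr.
have itE : iter (size (l :: u)) (@ordS N) j = j by rewrite -Ew -sw iter_ordS_N.
have qc : q = c j.
  by move: wk; rewrite [map _ _]/= walk_cons => /and3P[_ /eqP].
have [|||d [b [Rdb e1 e2]]] := @walk_match _ _ gH gK al be cp N x evenN sx
    (fun l => exists i, l = y i) _ u l j q _ wk.
- move=> _ i [i' ->]; have := xyP i i'.
  case: (x i) (y i') => [h|k] [h'|k'] //= h1 _ gg; have [z' Rz] := h1 (esym gg).
    exists (h^-1 * h'), z'; split=> //; first by rewrite -(am_H am) gmulVK.
    by rewrite -alM gmulVK.
  exists z', (k^-1 * k'); split=> //; first by rewrite (am_R am Rz) -(am_K am) gmulVK.
  by rewrite (albe _ _ Rz) -beM gmulVK.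
- move=> i il; have iN : i < N by rewrite sw Ew.
  by exists (Ordinal iN); rewrite /y Ew.
- rewrite itE; move: lst; rewrite qc [map _ _]/= [last _ _]/= last_map.
  by move/eqP.
rewrite itE mulVg mul1g in e2; rewrite -Ew -sw in e1.
have [[b' Rb'] De] := DP j d (ex_intro _ b Rdb) e1.
(* Equality is obtained in [G] only; the extension [f] of [al] transfers it to [P], without appeal
   to injectivity of [iH]. *)
have Dd : iH (D j) = iH d by apply: (@gmulI _ (evw (cpath x j N))); rewrite -De e1.
have Dj : D j = 1.
  by apply: alD; rewrite -fiH Dd fiH -e2; apply/eqP.
by apply: nc; rewrite De Dj (hom1 (am_H am)) gmul1r; apply: conj_cyc.
Qed.

End Hyperbolic.

(** * Short words against cyclically reduced words *)

Lemma evw_short (H K G : grp) (iH : H -> G) (iK : K -> G) (w : seq (H + K)) :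
  is_hom iH -> size w <= 1 -> (exists h, evw iH iK w = iH h) \/ (exists k, evw iH iK w = iK k).
Proof.
move=> hH; case: w => [|[h|k] [|l w]] //= _; first by left; exists 1; rewrite (hom1 hH).
  by left; exists h; rewrite gmul1r.
by right; exists k; rewrite gmul1r.
Qed.

Lemma amalgam_conj_p_separable p (H K : grp) (R : H -> K -> Prop) (G : grp) (iH : H -> G) (iK : K -> G) :
  prime p -> fin_generated H -> fin_generated K -> nilpotent_grp H -> nilpotent_grp K ->
  conj_p_separable p H -> conj_p_separable p K ->
  central_iso p R -> amalgam R iH iK -> conj_p_separable p G.
Proof.
move=> pp fH fK nH nK csH csK RP am a b nab.
suff [gT [psi [[psiM psi_onto pX] nc]]] : separated p a b by exists gT, psi.
have [wa [ca na]] := conj_normal_form am a; have [wb [cb nb]] := conj_normal_form am b.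
apply: (separated_conj ca cb).
have {a b nab ca cb} nc : ~ conj_in (evw iH iK wa) (evw iH iK wb).
  by move=> h; apply: nab; apply: conj_in_trans ca (conj_in_trans h (conj_in_sym cb)).
have nc' : ~ conj_in (evw iH iK wb) (evw iH iK wa) by move/conj_in_sym.
have sep := hyperbolic_separated pp RP am fH nH fK nK csH.
case: na nb => [sa|ra] [sb|rb].
- have am' := amalgam_sym am; have RP' := central_iso_sym RP.
  have sepKK k k' : ~ conj_in (iK k) (iK k') -> separated p (iK k) (iK k').
    exact: (elliptic_separated pp RP' am').
  have sepHK h k : ~ conj_in (iH h) (iK k) -> separated p (iH h) (iK k).
    (* An amalgamated [h] is also an element of [K], which reduces the mixed case to a single
       factor. *)
    move=> hk; have [[b Rhb]|no] := pselect (exists b, R h b).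
      by move: hk; rewrite (am_R am Rhb); apply: sepKK.
    by apply: (mixed_separated pp RP am) => // b Rhb; apply: no; exists b.
  move: nc nc'; have [[h ->]|[k ->]] := evw_short iK (am_H am) sa;
    have [[h' ->]|[k' ->]] := evw_short iK (am_H am) sb => nc nc'.
  + exact: (elliptic_separated pp RP am).
  + exact: sepHK.
  + by apply: separated_sym; apply: sepHK.
  + exact: sepKK.
- by apply/separated_sym/sep => //; case: rb => _ b0 _; apply: leq_trans sa b0.
- by apply: sep => //; case: ra => _ a0 _; apply: leq_trans sb a0.
(* The longer word supplies the cycle. *)
- have [ab|/ltnW ab] := leqP (size wb) (size wa); first exact: sep.
  by apply/separated_sym/sep.
Qed.

Theorem theorem3 (p : nat) (H K : grp) (A : H -> Prop) (B : K -> Prop)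
    (phi : H -> K) (G : grp) (iH : H -> G) (iK : K -> G) :
  prime p ->
  fin_generated H -> fin_generated K ->
  nilpotent_grp H -> nilpotent_grp K ->
  conj_p_separable p H -> conj_p_separable p K ->
  is_subgroup A -> is_subgroup B ->
  central A -> central B ->
  pprime_isolated p A -> pprime_isolated p B ->
  iso_on A B phi ->
  is_amalgam A phi iH iK ->
  conj_p_separable p G.
Proof.
move=> pp fH fK nH nK csH csK sA sB cA cB iA iB [phiB phiM phiI phi_onto] am.
apply: (amalgam_conj_p_separable pp fH fK nH nK csH csK _ (is_amalgam_amalgam am)).
have phi1 : phi 1 = 1.
  apply: (@gmulI _ (phi 1)); rewrite -phiM ?gmul1r ?gmul1 //; exact: sub1.
split.
- by split; [apply: sub1 | ].
- by move=> a _ a' _ [Aa <-] [Aa' <-]; rewrite phiM //; split=> //; apply: subM.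
- move=> a _ [Aa <-]; have AV := subV sA Aa; split=> //.
  by apply: ginv_uniq; rewrite -phiM // gmulVr phi1.
- by move=> a b b' [_ <-] [_ <-].
- by move=> a a' b [Aa <-] [Aa' e]; apply: phiI.
- by move=> a b [/cA].
- by move=> a b [Aa <-]; apply/cB/phiB.
- move=> q qP qp y [b [/(iA q qP qp) Ay _]].
  by exists (phi y).
- move=> q qP qp y [a [Aa e]]; have /phi_onto[a' Aa' <-] : B y.
    by apply: (iB q) => //; rewrite -e; apply: phiB.
  by exists a'.
Qed.
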